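(* For every integer $k\ge 2$, the set of unordered $k$-tuples $\{h_1,\dots,h_k\}\in X_k$ such that $\langle h_1,\dots,h_k\rangle = F$ has positive asymptotic density in $X_k$ with respect to the sum stratification, and also with respect to the max stratification. That is, in both models a random $k$-generated subgroup of $F$ equals $F$ with positive asymptotic probability.
   Context: Thompson's group $F$ is the group of piecewise linear homeomorphisms of $[0,1]$ with finitely many breakpoints, all at dyadic rationals, and all slopes integer powers of $2$. Every element of $F$ is represented by a unique reduced tree-diagram $(T_+,T_-)$: a pair of finite full binary trees with the same number of carets and no common carets. The size $|g|$ of $g\in F$ is the number of carets in each tree of its reduced tree-diagram. Let $X$ denote the set of reduced tree-diagrams, identified with $F$. Let $X_k$ denote the set of unordered $k$-tuples, i.e. multisets of size $k$, of elements of $X$. Sum stratification: $\|\{h_1,\dots,h_k\}\|_{\mathrm{sum}}=\sum_i |h_i|$, and $\mathrm{Sph}^{sum}_k(n)$ is the set of tuples of sum-size $n$. Max stratification: $\|\{h_1,\dots,h_k\}\|_{\max}=\max_i|h_i|$, and $\mathrm{Sph}^{max}_k(n)$ is defined analogously. A subset $T\subseteq X_k$ has positive asymptotic density with respect to a stratification with spheres $\mathrm{Sph}_k(n)$ if $\liminf_{n\to\infty} |T\cap \mathrm{Sph}_k(n)|/|\mathrm{Sph}_k(n)|>0$. *)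

(* Defs.v *)
From HB Require Import structures.
From mathcomp Require Import all_boot all_order all_algebra.
From mathcomp Require Import finmap multiset.
Set Implicit Arguments. Unset Strict Implicit. Unset Printing Implicit Defensive.
Import Order.TTheory GRing.Theory Num.Theory.
Open Scope mset_scope.

Inductive tree := Leaf | Node of tree & tree.

Fixpoint tree_code (t : tree) : GenTree.tree unit :=
  match t with
  | Leaf => GenTree.Leaf tt
  | Node l r => GenTree.Node 0 [:: tree_code l; tree_code r]
  end.
Fixpoint tree_decode (c : GenTree.tree unit) : option tree :=
  match c with
  | GenTree.Leaf _ => Some Leaf
  | GenTree.Node _ [:: cl; cr] =>
      match tree_decode cl, tree_decode cr with
      | Some l, Some r => Some (Node l r)
      | _, _ => None
      end
  | _ => None
  end.
Lemma tree_codeK : pcancel tree_code tree_decode.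
Proof. by elim=> [|l IHl r IHr] //=; rewrite IHl IHr. Qed.
HB.instance Definition _ := Countable.copy tree (pcan_type tree_codeK).

Fixpoint carets (t : tree) : nat :=
  match t with Leaf => 0 | Node l r => (carets l + carets r).+1 end.

Fixpoint nleaves (t : tree) : nat :=
  match t with Leaf => 1 | Node l r => nleaves l + nleaves r end.

(* Exposed carets: the list of indices i (leaves numbered from 0, left to
   right, starting at offset o) such that leaves i and i+1 are the two
   children of a single caret of t. *)
Fixpoint exposed (t : tree) (o : nat) : seq nat :=
  match t with
  | Leaf => [::]
  | Node Leaf Leaf => [:: o]
  | Node l r => exposed l o ++ exposed r (o + nleaves l)
  end.

Definition diagram := (tree * tree)%type.

Definition reduced (d : diagram) : bool :=
  (carets d.1 == carets d.2) &&
  ~~ has (fun i => i \in exposed d.2 0) (exposed d.1 0).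

(* X = the set of reduced tree-diagrams, identified with F *)
Definition X := {d : diagram | reduced d}.
HB.instance Definition _ := [isSub of X for @proj1_sig diagram reduced].
HB.instance Definition _ := [Countable of X by <:].

Definition gsize (g : X) : nat := carets (val g).1.

Local Open Scope ring_scope.

Fixpoint leaf_intervals (t : tree) (a b : rat) : seq (rat * rat) :=
  match t with
  | Leaf => [:: (a, b)]
  | Node l r => let m := (a + b) / 2%:R in
                leaf_intervals l a m ++ leaf_intervals r m b
  end.

(* the piecewise linear map sending the i-th leaf interval of T+ affinely
   onto the i-th leaf interval of T-; identity outside [0,1]. *)
Fixpoint pl_eval (s : seq ((rat * rat) * (rat * rat))) (x : rat) : rat :=
  match s with
  | [::] => x
  | ((a, b), (c, d)) :: s' =>
      if (a <= x) && (x <= b) then c + (x - a) * (d - c) / (b - a)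
      else pl_eval s' x
  end.

Definition diag_fun (d : diagram) : rat -> rat :=
  pl_eval (zip (leaf_intervals d.1 0 1) (leaf_intervals d.2 0 1)).

Definition elt (g : X) : rat -> rat := diag_fun (val g).
Definition elt_inv (g : X) : rat -> rat := diag_fun ((val g).2, (val g).1).

Definition word_fun (w : seq (X * bool)) : rat -> rat :=
  foldr (fun (l : X * bool) f => (if l.2 then elt l.1 else elt_inv l.1) \o f)
        id w.

Definition generates_F (A : {mset X}) : Prop :=
  forall g : X, exists w : seq (X * bool),
    all (fun l => l.1 \in A) w /\ word_fun w =1 elt g.

Local Close Scope ring_scope.

Definition sum_norm (A : {mset X}) : nat := \sum_(h <- A) gsize h.
Definition max_norm (A : {mset X}) : nat := \max_(h <- A) gsize h.

Definition Sph_sum (k n : nat) : pred {mset X} :=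
  fun A => (size A == k) && (sum_norm A == n).
Definition Sph_max (k n : nat) : pred {mset X} :=
  fun A => (size A == k) && (max_norm A == n).

Definition card_is (T : eqType) (P : T -> Prop) (c : nat) : Prop :=
  exists s : seq T, [/\ uniq s, forall x, x \in s <-> P x & size s = c].

Definition pos_density (Sph : nat -> pred {mset X}) (S : {mset X} -> Prop) :
  Prop :=
  exists eps : rat, (0 < eps)%R /\ exists N : nat, forall n, N <= n ->
    forall a b : nat,
      card_is (fun A => Sph n A /\ S A) a -> card_is (Sph n) b ->
      (eps <= a%:R / b%:R)%R.

(* Main.v *)
Require Import Defs.
From mathcomp Require Import all_boot all_order all_algebra.
From mathcomp Require Import finmap multiset.
From mathcomp Require Import zify ring lra.

Set Implicit Arguments. Unset Strict Implicit. Unset Printing Implicit Defensive.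
Import Order.TTheory GRing.Theory Num.Theory.

Open Scope mset_scope.

(**
Generation. Write [(t u)] for the tree with subtrees [t] and [u], and [.] for a
leaf. Let [f] be the diagram [(((. A) .) (. .)) -> ((. A') ((. .) .))] and [g] the diagram
[(. ((. .) (B .))) -> (. (. (. (B' .))))], where [(A, A')] and [(B, B')] are
arbitrary diagrams. Where one of [f], [g] acts by its arbitrary part the other
is the identity, so [g^-1 f g f^-1] does not depend on these parts; it is the
rotation at the node [10]. Its conjugate by [f] is the rotation at [101], so
<f, g> contains all of the copy of F supported on [[1/2, 3/4]]. Conjugating by
powers of [f] and [g] moves the end points of this interval to 0 and 1, and
[f], [g] have independent germs at 0 and 1; hence <f, g> = F. All this is
carried out with trees: a subgroup is encoded by the congruence relating [t]
and [u] when the element with diagram [(t, u)] is in the subgroup.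

Density. Inserting two members of a k-tuple in [f] and [g] maps the sphere of
radius n injectively to generating tuples in the sphere of radius n + 12 (sum)
or n + 6 (max). It remains to bound the growth of spheres, which reduces to
r(n + 1) = O(r(n)) for the number r(n) of reduced diagrams with n carets. To
this end remove leaf [i] from both trees of a reduced diagram. Among any seven
consecutive leaves there is one whose removal leaves a reduced diagram, or else
three leaves spanning a subtree in both trees which can be collapsed to one
leaf. The removal is undone by knowing [i] and, for each tree, a side and the
length of a spine of the sibling of leaf [i]; these lengths add up to at most
twice the number of carets, so all but a small proportion of them is bounded.
Hence n r(n) = O(n (r(n - 1) + r(n - 2))).
*)

(** * Functions of tree diagrams *)

Section PiecewiseLinear.
Local Open Scope ring_scope.

(** Records that [s] subdivides [a, b] into abutting nondegenerate intervals. This is the property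
    of [leaf_intervals] used below, and it allows induction on lists instead of trees. *)
Fixpoint chain (a b : rat) (s : seq (rat * rat)) : Prop :=
  match s with
  | [::] => a = b
  | (c, d) :: s' => [/\ c = a, c < d & chain d b s']
  end.

Lemma chain_le a b s : chain a b s -> a <= b.
Proof.
elim: s a => [|[c d] s IH] a /= => [->//|[-> ad /IH db]].
exact: le_trans (ltW ad) db.
Qed.

Lemma chain_cat a b c s1 s2 :
  chain a b s1 -> chain b c s2 -> chain a c (s1 ++ s2).
Proof. by elim: s1 a => [|[x y] s IH] a /= => [->//|[-> xy h] h2]; split=> //; exact: IH. Qed.

Lemma chain_leaf_intervals t a b : a < b -> chain a b (leaf_intervals t a b).
Proof.
elim: t a b => [|l IHl r IHr] a b ab /=; first by [].
apply: (@chain_cat _ ((a + b) / 2%:R)); [apply: IHl|apply: IHr]; lra.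
Qed.

Lemma size_leaf_intervals t a b : size (leaf_intervals t a b) = nleaves t.
Proof. by elim: t a b => //= l IHl r IHr a b; rewrite size_cat IHl IHr. Qed.

(** Strictness matters: pieces are closed and tried in order, so in a composition a point beyond the
    first piece must be mapped strictly beyond the image of that piece. *)
Lemma pl_eval_gt s1 s2 a b c d x : chain a b s1 -> chain c d s2 ->
  size s1 = size s2 -> a < x -> x <= b -> c < pl_eval (zip s1 s2) x.
Proof.
elim: s1 s2 a c => [|[p q] s1 IH] [|[u v] s2] a c //=.
  by move=> -> _ _ /lt_le_trans h /h; rewrite ltxx.
move=> [-> aq h1] [-> cv h2] [e] ax xb; rewrite (ltW ax) /=.
case: (leP x q) => xq.
  by rewrite ltrDl divr_gt0 ?mulr_gt0 ?subr_gt0.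
by apply: (lt_trans cv); apply: IH h1 h2 e _ _.
Qed.

Lemma pl_eval_out s1 s2 a b x : chain a b s1 -> x < a \/ b < x ->
  pl_eval (zip s1 s2) x = x.
Proof.
elim: s1 s2 a => [|[p q] s1 IH] [|[u v] s2] a //= [-> aq h1] hx.
have qb := chain_le h1.
have -> : (a <= x) && (x <= q) = false.
  by apply/negbTE/negP => /andP[ax xq]; case: hx; lra.
by apply: IH h1 _; case: hx => hx; [left|right]; lra.
Qed.

Lemma pl_eval_comp s1 s2 s3 a b c d u v x :
  chain a b s1 -> chain c d s2 -> chain u v s3 ->
  size s1 = size s2 -> size s2 = size s3 -> (0 < size s1)%N ->
  a <= x -> x <= b ->
  pl_eval (zip s2 s3) (pl_eval (zip s1 s2) x) = pl_eval (zip s1 s3) x.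
Proof.
elim: s1 s2 s3 a c u => [|[p q] s1 IH] [|[p2 q2] s2] [|[p3 q3] s3] a c u //=.
move=> [-> aq h1] [-> cq h2] [-> uq h3] [e1] [e2] _ ax xb; rewrite ax /=.
case: (leP x q) => xq.
  have h : 0 <= (x - a) / (q - a) <= 1.
    rewrite divr_ge0 ?subr_ge0 ?(ltW aq) //= ler_pdivrMr ?subr_gt0 // mul1r.
    by rewrite lerD2r.
  set y := c + _; have yE : y = c + (x - a) / (q - a) * (q2 - c).
    by rewrite /y mulrAC.
  have -> : (c <= y) && (y <= q2).
    move: h => /andP[h0 h1']; rewrite yE; apply/andP; split; nra.
  by rewrite yE; field; apply/andP; split; lra.
have := pl_eval_gt h1 h2 e1 xq xb; set y := pl_eval _ _ => yq.
have -> : (y <= q2) = false by apply/negbTE; rewrite -ltNge.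
rewrite andbF; apply: (IH _ _ _ _ _ h1 h2 h3 e1 e2 _ (ltW xq) xb).
by move: h1; case: (s1) => //= h1; lra.
Qed.

Lemma pl_eval_id s x : pl_eval (zip s s) x = x.
Proof.
elim: s => [|[a b] s IH] //=; case: ifP => // /andP[ax xb].
have [e|ne] := eqVneq b a; last by field; lra.
have -> : x = a by lra.
by rewrite subrr !mul0r addr0.
Qed.

(** Halving source and target keeps the slope, so a common subdivision does not change the affine
    map. The tail [s] lets the induction treat the left half in front of the right one. *)
Lemma pl_eval_leaf_intervals t a b c d s x : a < b ->
  pl_eval (zip (leaf_intervals t a b) (leaf_intervals t c d) ++ s) x =
  pl_eval (((a, b), (c, d)) :: s) x.
Proof.
elim: t a b c d s => [|l IHl r IHr] a b c d s ab //.
rewrite [leaf_intervals _ a b]/= [leaf_intervals _ c d]/=.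
rewrite zip_cat ?size_leaf_intervals // -catA IHl; last by lra.
rewrite /= IHr /=; last by lra.
have [ax|ax] /= := leP a x; last first.
  have -> // : ((a + b) / 2 <= x) = false by apply/negbTE; rewrite -ltNge; lra.
have [xm|xm] /= := leP x ((a + b) / 2).
  have -> : x <= b by lra.
  by field; lra.
rewrite (ltW xm) /=; case: ifP => // xb; field; lra.
Qed.

End PiecewiseLinear.

Fixpoint graft (t : tree) (ss : seq tree) : tree :=
  match t with
  | Leaf => head Leaf ss
  | Node l r => Node (graft l (take (nleaves l) ss)) (graft r (drop (nleaves l) ss))
  end.

Lemma leaf_intervals_graft t ss a b : size ss = nleaves t ->
  leaf_intervals (graft t ss) a b =
  flatten [seq leaf_intervals p.1 p.2.1 p.2.2 | p <- zip ss (leaf_intervals t a b)].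
Proof.
elim: t ss a b => [|l IHl r IHr] ss a b /=.
  by case: ss => [|s [|]] //= _; rewrite cats0.
move=> e; rewrite IHl ?IHr ?size_drop ?size_takel ?e ?leq_addr //; last by lia.
rewrite -[ss in RHS](cat_take_drop (nleaves l)) zip_cat ?map_cat ?flatten_cat //.
by rewrite size_leaf_intervals size_takel // e leq_addr.
Qed.

(** Expanding both trees by the same list gives an unreduced diagram of the same element. *)
Lemma diag_fun_graft t1 t2 ss : size ss = nleaves t1 -> nleaves t1 = nleaves t2 ->
  diag_fun (graft t1 ss, graft t2 ss) =1 diag_fun (t1, t2).
Proof.
move=> e1 e2 x; rewrite /diag_fun /= !leaf_intervals_graft -?e2 //.
have ch := @chain_leaf_intervals t1 0%R 1%R ltr01.
move: (size_leaf_intervals t1 0%R 1%R) (size_leaf_intervals t2 0%R 1%R).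
rewrite -e2 -e1; move: ch; move: (leaf_intervals t1 _ _) (leaf_intervals t2 _ _).
move: (0%R) => a0 s1 s2.
elim: ss s1 s2 a0 {e1} => [|t ss IH] [|[a b] s1] [|[c d] s2] a0 //= [-> ab ch] [e1] [e2'].
rewrite zip_cat ?size_leaf_intervals // pl_eval_leaf_intervals //=.
by rewrite (IH _ _ _ ch).
Qed.

Lemma nleaves_gt0 t : 0 < nleaves t.
Proof. by elim: t => //= l hl r hr; lia. Qed.

Lemma nleaves_carets t : nleaves t = (carets t).+1.
Proof. by elim: t => //= l -> r ->; lia. Qed.

Lemma diag_fun_comp t1 t2 t3 : nleaves t1 = nleaves t2 -> nleaves t2 = nleaves t3 ->
  diag_fun (t2, t3) \o diag_fun (t1, t2) =1 diag_fun (t1, t3).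
Proof.
move=> e1 e2 x; rewrite /diag_fun /=.
have ch t := @chain_leaf_intervals t 0%R 1%R ltr01.
have [/andP[h0 h1]|out] := boolP ((0 <= x) && (x <= 1))%R.
  apply: (pl_eval_comp (ch _) (ch _) (ch _)); rewrite ?size_leaf_intervals //.
  exact: nleaves_gt0.
have {}out : (x < 0 \/ 1 < x)%R by move: out; rewrite negb_and -!ltNge => /orP.
by rewrite !(pl_eval_out _ (ch _)).
Qed.

Lemma diag_fun_id t : diag_fun (t, t) =1 id.
Proof. by move=> x; exact: pl_eval_id. Qed.

(** * Generation *)

Definition in_subgroup (A : {mset X}) (f : rat -> rat) : Prop :=
  exists w : seq (X * bool), all (fun l => l.1 \in A) w /\ word_fun w =1 f.

Lemma word_fun_cat w1 w2 : word_fun (w1 ++ w2) =1 word_fun w1 \o word_fun w2.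
Proof. by elim: w1 => [|l w IH] x //=; rewrite IH. Qed.

Lemma in_subgroup_comp A f1 f2 :
  in_subgroup A f1 -> in_subgroup A f2 -> in_subgroup A (f1 \o f2).
Proof.
move=> [w1 [a1 e1]] [w2 [a2 e2]]; exists (w1 ++ w2); split; first by rewrite all_cat a1.
by move=> x; rewrite word_fun_cat /= e2 e1.
Qed.

Lemma in_subgroup_eq A f1 f2 : f1 =1 f2 -> in_subgroup A f1 -> in_subgroup A f2.
Proof. by move=> e [w [a e1]]; exists w; split=> // x; rewrite e1 e. Qed.

Lemma reduced_nleaves d : reduced d -> nleaves d.1 = nleaves d.2.
Proof. by case/andP=> /eqP e _; rewrite !nleaves_carets e. Qed.

Lemma eltK (g : X) : elt_inv g \o elt g =1 id.
Proof.
move: (valP g) => /reduced_nleaves; rewrite /elt /elt_inv.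
case: (val g) => t1 t2 /= e x.
by rewrite (@diag_fun_comp t1 t2 t1) ?diag_fun_id.
Qed.

Lemma elt_invK (g : X) : elt g \o elt_inv g =1 id.
Proof.
move: (valP g) => /reduced_nleaves; rewrite /elt /elt_inv.
case: (val g) => t1 t2 /= e x.
by rewrite (@diag_fun_comp t2 t1 t2) ?diag_fun_id.
Qed.

Lemma in_subgroup_inv A f1 f2 : f2 \o f1 =1 id -> f1 \o f2 =1 id ->
  in_subgroup A f1 -> in_subgroup A f2.
Proof.
move=> e21 e12 [w [a e]].
exists (rev [seq (l.1, ~~ l.2) | l <- w]); split.
  by rewrite all_rev all_map; apply: sub_all a.
have inv x : word_fun (rev [seq (l.1, ~~ l.2) | l <- w]) (word_fun w x) = x.
  elim: w x {a e} => [|[g b] w IH] x //=; rewrite rev_cons -cats1 word_fun_cat /=.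
  by case: b => /=; rewrite [X in word_fun _ X](eltK, elt_invK) IH.
(* Write x as f1 (f2 x), express f1 by the word [w], and cancel it with the inverse word. *)
by move=> x; rewrite -{1}[x]e12 /= -e inv.
Qed.

(** Equivalence encodes the group laws; [cc_graft] and [cc_cancel] say that expanding or reducing a
    diagram does not change its element. The generation argument uses only these rules. *)
Record cancellative_congruence (R : tree -> tree -> Prop) : Prop := CancellativeCongruence {
  cc_nleaves : forall t u, R t u -> nleaves t = nleaves u;
  cc_refl : forall t, R t t;
  cc_sym : forall t u, R t u -> R u t;
  cc_trans : forall t u v, R t u -> R u v -> R t v;
  cc_graft : forall t u ss, size ss = nleaves t -> R t u -> R (graft t ss) (graft u ss);
  cc_cancel : forall t u ss, size ss = nleaves t -> nleaves t = nleaves u ->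
    R (graft t ss) (graft u ss) -> R t u }.

Definition tree_rel (A : {mset X}) (t u : tree) : Prop :=
  nleaves t = nleaves u /\ in_subgroup A (diag_fun (t, u)).

Lemma nleaves_graft t ss : size ss = nleaves t ->
  nleaves (graft t ss) = sumn [seq nleaves s | s <- ss].
Proof.
elim: t ss => [|l IHl r IHr] ss /=; first by case: ss => [|s [|]] //= _; rewrite addn0.
move=> e; rewrite IHl ?IHr ?size_drop ?size_takel ?e ?leq_addr //; last by lia.
by rewrite -[in RHS](cat_take_drop (nleaves l) ss) map_cat sumn_cat.
Qed.

Lemma tree_rel_congruence A : cancellative_congruence (tree_rel A).
Proof.
split.
- by move=> t u [].
- move=> t; split=> //; exists [::]; split=> // x; by rewrite diag_fun_id.
- move=> t u [e h]; split=> //; apply: in_subgroup_inv h => x.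
    by rewrite diag_fun_comp ?diag_fun_id.
  by rewrite diag_fun_comp ?diag_fun_id.
- move=> t u v [e1 h1] [e2 h2]; split; first by rewrite e1.
  by apply: in_subgroup_eq (in_subgroup_comp h2 h1); apply: diag_fun_comp.
- move=> t u ss es [e h]; split; first by rewrite !nleaves_graft -?e.
  by apply: in_subgroup_eq h => x; rewrite diag_fun_graft.
- move=> t u ss es e [_ h]; split=> //.
  by apply: in_subgroup_eq h; apply: diag_fun_graft.
Qed.


Lemma graft_node l r s1 s2 : size s1 = nleaves l ->
  graft (Node l r) (s1 ++ s2) = Node (graft l s1) (graft r s2).
Proof. by move=> e /=; rewrite -e take_size_cat ?drop_size_cat. Qed.

Local Notation N := Node.
Local Notation o := Leaf.

Lemma graft_leaves t n : n = nleaves t -> graft t (nseq n o) = t.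
Proof.
move=> ->; elim: t => //= l IHl r IHr.
by rewrite nseqD take_size_cat ?drop_size_cat ?size_nseq // IHl IHr.
Qed.

(* The trees of the two generators, with a tree inserted at one leaf. *)
Definition f_src a := N (N (N o a) o) (N o o).
Definition f_tgt a := N (N o a) (N (N o o) o).
Definition g_src b := N o (N (N o o) (N b o)).
Definition g_tgt b := N o (N o (N o (N b o))).

Fixpoint full k := if k is k'.+1 then N (full k') (full k') else o.

Definition extends (a t : tree) := exists2 u, size u = nleaves a & t = graft a u.

(** Every subtree hanging off the left spine has [a] as an initial subtree. This is what repeated
    application of [f] towards 0 requires; the mirror condition below serves [g] at 1. *)
Fixpoint left_spine_extends a t : Prop :=
  if t is N t' s then left_spine_extends a t' /\ extends a s else True.

Fixpoint right_spine_extends b t : Prop :=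
  if t is N s t' then extends b s /\ right_spine_extends b t' else True.

(** Once all leaves lie deep enough, [a] fits at the root. Whether [l] is a leaf or a node, the
    grafted tree splits into two trees of the same kind, so induction on [a] applies. *)
Lemma extends_full a : exists k0, forall k, k0 <= k ->
  forall l m, m = nleaves l -> extends a (graft l (nseq m (full k))).
Proof.
elim: a => [|a1 [k1 IH1] a2 [k2 IH2]].
  by exists 0 => k _ l m _; exists [:: graft l (nseq m (full k))].
exists (maxn k1 k2).+1 => -[|k] // hk l m ->.
suff [t1 [t2 [-> [u1 e1 ->] [u2 e2 ->]]]] : exists t1 t2,
    [/\ graft l (nseq (nleaves l) (full k.+1)) = N t1 t2, extends a1 t1 & extends a2 t2].
  by exists (u1 ++ u2); rewrite ?size_cat ?e1 ?e2 // graft_node.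
case: l => [|l1 l2] /=.
  exists (full k), (full k); split=> //.
    by apply: (IH1 k _ o 1 erefl); lia.
  by apply: (IH2 k _ o 1 erefl); lia.
rewrite nseqD take_size_cat ?drop_size_cat ?size_nseq //.
exists (graft l1 (nseq (nleaves l1) (full k.+1))), (graft l2 (nseq (nleaves l2) (full k.+1))).
by split=> //; [apply: IH1|apply: IH2] => //; lia.
Qed.

(** * Normal forms of trees modulo the two generators *)

Section Normalisation.
Variables (R : tree -> tree -> Prop) (A A' B B' : tree).
Hypotheses (RC : cancellative_congruence R).
Hypotheses (hf : R (f_src A) (f_tgt A')) (hg : R (g_src B) (g_tgt B')).

Let nA : nleaves A = nleaves A'.
Proof. by have := cc_nleaves RC hf => /=; lia. Qed.
Let nB : nleaves B = nleaves B'.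
Proof. by have := cc_nleaves RC hg => /=; lia. Qed.

Let refl t : R t t. Proof. exact: cc_refl. Qed.
Let sym t u : R t u -> R u t. Proof. exact: cc_sym. Qed.
Let trans t u v : R t u -> R u v -> R t v. Proof. exact: cc_trans. Qed.

Lemma f_rel a u b c d : size u = nleaves A ->
  R (N (N (N a (graft A u)) b) (N c d)) (N (N a (graft A' u)) (N (N b c) d)).
Proof.
move=> eu; pose ss := (([:: a] ++ u) ++ [:: b]) ++ ([:: c] ++ [:: d]).
have eS : graft (f_src A) ss = N (N (N a (graft A u)) b) (N c d).
  by rewrite /ss !graft_node // ?size_cat /= eu.
have eT : graft (f_tgt A') ss = N (N a (graft A' u)) (N (N b c) d).
  have -> : ss = ([:: a] ++ u) ++ (([:: b] ++ [:: c]) ++ [:: d]) by rewrite /ss -!catA.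
  by rewrite !graft_node // ?size_cat /= eu nA.
rewrite -eS -eT; apply: (cc_graft RC) hf.
by rewrite !size_cat /= eu; lia.
Qed.

Lemma g_rel a b c v d : size v = nleaves B ->
  R (N a (N (N b c) (N (graft B v) d))) (N a (N b (N c (N (graft B' v) d)))).
Proof.
move=> ev; pose ss := [:: a] ++ (([:: b] ++ [:: c]) ++ (v ++ [:: d])).
have eS : graft (g_src B) ss = N a (N (N b c) (N (graft B v) d)).
  by rewrite /ss !graft_node.
have eT : graft (g_tgt B') ss = N a (N b (N c (N (graft B' v) d))).
  have -> : ss = [:: a] ++ ([:: b] ++ ([:: c] ++ (v ++ [:: d]))) by rewrite /ss -!catA.
  by rewrite !graft_node // ev nB.
rewrite -eS -eT; apply: (cc_graft RC) hg.
by rewrite !size_cat /= ev; lia.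
Qed.

Let oA := nseq (nleaves A) o.
Let oB := nseq (nleaves B) o.
Let szA : size oA = nleaves A. Proof. exact: size_nseq. Qed.
Let szB : size oB = nleaves B. Proof. exact: size_nseq. Qed.

(* The commutator-like word [g^-1 f g f^-1] cancels both inserted diagrams and
   is a rotation at the node [10]. *)
Lemma rotation_10 a b c d e :
  R (N a (N (N b (N c d)) e)) (N a (N (N (N b c) d) e)).
Proof.
(* [Y] and [e'] contain the inserted trees, so both generators can be applied in either direction;
   they are cancelled at the end. *)
pose Y := N o (graft A' oA); pose e' := N (graft B oB) o.
have key : R (N Y (N (N o (N o o)) e')) (N Y (N (N (N o o) o) e')).
  apply: trans (sym (f_rel _ _ _ _ szA)) _.
  apply: trans (g_rel _ _ _ _ szB) _.
  apply: trans (f_rel _ _ _ _ szA) _.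
  exact: sym (g_rel _ _ _ _ szB).
have base : R (N o (N (N o (N o o)) o)) (N o (N (N (N o o) o) o)).
  exact: (cc_cancel RC (ss := [:: Y; o; o; o; e'])).
exact: (cc_graft RC (ss := [:: a; b; c; d; e])) base.
Qed.

(** The diagram (t, u) acting in the copy of F at the node [10], that is on [1/2, 3/4]. *)
Definition rel_10 t u := R (N o (N t o)) (N o (N u o)).

Lemma rel_10P t u a e : rel_10 t u -> R (N a (N t e)) (N a (N u e)).
Proof.
move=> h; have et : nleaves t = nleaves u by have := cc_nleaves RC h => /=; lia.
have := @cc_graft _ RC _ _ ([:: a] ++ (nseq (nleaves t) o ++ [:: e])) _ h.
rewrite graft_node // graft_node ?size_nseq // graft_node // graft_node ?size_nseq //.
rewrite !graft_leaves //; apply.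
by rewrite !size_cat size_nseq /=; lia.
Qed.

Lemma rel_10_cancel t u Y e : nleaves t = nleaves u ->
  R (N Y (N t e)) (N Y (N u e)) -> rel_10 t u.
Proof.
move=> et h.
apply: (cc_cancel RC (ss := [:: Y] ++ (nseq (nleaves t) o ++ [:: e]))).
- by rewrite !size_cat size_nseq /=; lia.
- by rewrite /= et.
rewrite graft_node // graft_node ?size_nseq // graft_node // graft_node ?size_nseq //.
by rewrite !graft_leaves.
Qed.

(* Conjugation by [f] moves the node [10] to [101]. *)
Lemma rel_10_right b t u : rel_10 t u -> rel_10 (N b t) (N b u).
Proof.
move=> h; have et : nleaves t = nleaves u by have := cc_nleaves RC h => /=; lia.
apply: (@rel_10_cancel _ _ (N o (graft A' oA)) o); first by rewrite /= et.
apply: trans (sym (f_rel _ _ _ _ szA)) _.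
apply: trans (rel_10P _ _ h) _.
exact: f_rel.
Qed.

Fixpoint comb n := if n is n'.+1 then N o (comb n') else o.

(** While the left child is a node, [rotation_10] moves carets to the right; once it is a leaf,
    [rel_10_right] passes to the right subtree. The outer induction is on all carets, the inner one
    on those of the left child. *)
Lemma rel_10_comb t : rel_10 t (comb (carets t)).
Proof.
have [n] := ubnP (carets t); elim: n t => // n IHn t ht.
case: t ht => [|l r] ht; first exact: refl.
have [m] := ubnP (carets l); elim: m l r ht => // m IHm l r ht hl.
case: l ht hl => [|l1 l2] ht hl.
  by apply: (@rel_10_right o r (comb (carets r))); apply: IHn; move: ht => /=; lia.
have -> : carets (N (N l1 l2) r) = carets (N l1 (N l2 r)) by rewrite /=; lia.
apply: trans (sym (rotation_10 _ _ _ _ _)) _.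
by apply: IHm; move: ht hl => /=; lia.
Qed.

Lemma rel_10_total t u : nleaves t = nleaves u -> rel_10 t u.
Proof.
rewrite !nleaves_carets => -[e].
apply: trans (rel_10_comb t) _; rewrite e; exact: sym (rel_10_comb u).
Qed.

(** With a suitable tree in place of [a], applying [f] gathers [b] and [c] into one tree at the node
    [10], where [rel_10_total] applies. So the interval of control grows to [1/4, 3/4]. *)
Lemma shift_01_10 a b c b' c' d : nleaves b + nleaves c = nleaves b' + nleaves c' ->
  R (N (N a b) (N c d)) (N (N a b') (N c' d)).
Proof.
move=> e; pose Y := N o (graft A oA).
pose ss x y := [:: x] ++ nseq (nleaves b + nleaves c) o ++ [:: y].
have gr x y b1 c1 : nleaves b1 + nleaves c1 = nleaves b + nleaves c ->
    graft (N (N o b1) (N c1 o)) (ss x y) = N (N x b1) (N c1 y).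
  move=> e1; rewrite /ss -e1 nseqD -catA catA.
  by rewrite !graft_node ?size_cat ?size_nseq // !graft_leaves.
have sz x y b1 c1 : nleaves b1 + nleaves c1 = nleaves b + nleaves c ->
    size (ss x y) = nleaves (N (N o b1) (N c1 o)).
  by move=> e1; rewrite !size_cat size_nseq /=; lia.
have base : R (N (N o b) (N c o)) (N (N o b') (N c' o)).
  apply: (cc_cancel RC (sz Y o _ _ _)) => //; first by move: e => /=; lia.
  rewrite !gr //; apply: trans (f_rel _ _ _ _ szA) _.
  apply: trans (sym (f_rel _ _ _ _ szA)).
  by apply: rel_10P; apply: rel_10_total.
by have := cc_graft RC (sz a d _ _ erefl) base; rewrite !gr.
Qed.

(** The inverse of [g] gathers [b] and [c] at the node [10], which reduces this to [shift_01_10];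
    the interval becomes [1/4, 7/8]. *)
Lemma shift_01_10_110 a s b c s' b' c' d :
  nleaves s + nleaves b + nleaves c = nleaves s' + nleaves b' + nleaves c' ->
  R (N (N a s) (N b (N c d))) (N (N a s') (N b' (N c' d))).
Proof.
move=> e; pose Z := N (graft B' oB) o.
pose ss x y := [:: x] ++ nseq (nleaves s + nleaves b + nleaves c) o ++ [:: y].
have gr x y s1 b1 c1 : nleaves s1 + nleaves b1 + nleaves c1 =
      nleaves s + nleaves b + nleaves c ->
    graft (N (N o s1) (N b1 (N c1 o))) (ss x y) = N (N x s1) (N b1 (N c1 y)).
  move=> e1; rewrite /ss -e1 !nseqD -!catA catA.
  by rewrite !graft_node ?size_cat ?size_nseq // !graft_leaves.
have sz x y s1 b1 c1 : nleaves s1 + nleaves b1 + nleaves c1 =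
      nleaves s + nleaves b + nleaves c ->
    size (ss x y) = nleaves (N (N o s1) (N b1 (N c1 o))).
  by move=> e1; rewrite !size_cat size_nseq /=; lia.
have base : R (N (N o s) (N b (N c o))) (N (N o s') (N b' (N c' o))).
  apply: (cc_cancel RC (sz o Z _ _ _ _)) => //; first by move: e => /=; lia.
  rewrite !gr //; apply: trans (sym (g_rel _ _ _ _ szB)) _.
  apply: trans (g_rel _ _ _ _ szB).
  by apply: shift_01_10 => /=; lia.
by have := cc_graft RC (sz a d _ _ _ erefl) base; rewrite !gr.
Qed.

(** Each application of [f] removes one caret from the left spine below the node [00] and pushes the
    hanging trees to the right. *)
Lemma shorten_left_spine a s t d : left_spine_extends A a ->
  exists s' t', R (N (N a s) (N t d)) (N (N o s') (N t' d)).
Proof.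
elim: a s t => [|a IH x _] s t /=; first by exists s, t.
move=> [ha [u eu ->]]; have [s' [t' h]] := IH (graft A' u) (N s t) ha.
by exists s', t'; apply: trans h; apply: f_rel.
Qed.

Lemma shorten_right_spine a b c d : right_spine_extends B' d ->
  exists b' c', R (N a (N b (N c d))) (N a (N b' (N c' o))).
Proof.
elim: d b c => [|x _ d IH] b c /=; first by exists b, c.
move=> [[v ev ->] hd]; have [b' [c' h]] := IH (N b c) (graft B v) hd.
by exists b', c'; apply: trans h; apply/sym/g_rel; rewrite ev nB.
Qed.

Lemma normal_form a s b c d : left_spine_extends A a -> right_spine_extends B' d ->
  exists s' b' c', R (N (N a s) (N b (N c d))) (N (N o s') (N b' (N c' o))).
Proof.
move=> ha hd; have [b1 [c1 h1]] := shorten_right_spine (N a s) b c hd.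
have [s' [b' h2]] := shorten_left_spine s b1 (N c1 o) ha.
by exists s', b', c1; apply: trans h2.
Qed.

Lemma graft_left_spine W l : extends A W ->
  (forall t, extends A (graft t (nseq (nleaves t) W))) ->
  exists a s, [/\ graft l (N (N o W) W :: nseq (nleaves l).-1 W) = N a s,
    left_spine_extends A a & extends A s].
Proof.
move=> hW hW'; elim: l => [|l1 [a [s [e1 h1 h2]]] l2 _].
  by exists (N o W), W.
exists (N a s), (graft l2 (nseq (nleaves l2) W)); split=> //.
have -> : N (N o W) W :: nseq (nleaves (N l1 l2)).-1 W =
          (N (N o W) W :: nseq (nleaves l1).-1 W) ++ nseq (nleaves l2) W.
  by rewrite cat_cons -nseqD /=; congr (_ :: nseq _ _); have := nleaves_gt0 l1; lia.
by rewrite graft_node ?e1 //= size_nseq; have := nleaves_gt0 l1; lia.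
Qed.

Lemma graft_right_spine W r : extends B' W ->
  (forall t, extends B' (graft t (nseq (nleaves t) W))) ->
  exists b c d, [/\ graft r (nseq (nleaves r).-1 W ++ [:: N W (N W (N W o))]) = N b (N c d),
    extends B' b, extends B' c & right_spine_extends B' d].
Proof.
move=> hW hW'; elim: r => [|r1 _ r2 [b [c [d [e1 h1 h2 h3]]]]].
  by exists W, W, (N W o).
exists (graft r1 (nseq (nleaves r1) W)), b, (N c d); split=> //.
have -> : nseq (nleaves (N r1 r2)).-1 W = nseq (nleaves r1) W ++ nseq (nleaves r2).-1 W.
  by rewrite -nseqD /=; congr nseq; have := nleaves_gt0 r2; lia.
by rewrite -catA graft_node ?size_nseq // e1.
Qed.

(** After a common expansion both trees have normal forms with a single leaf at [00] and at [111];
    these are related by [shift_01_10_110] because they have equally many leaves. *)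
Lemma tree_rel_total t u : nleaves t = nleaves u -> R t u.
Proof.
case: t => [|l r] e.
  case: u e => [|l r] /=; first by move=> _; exact: refl.
  by have := (nleaves_gt0 l, nleaves_gt0 r) => -[]; lia.
case: u e => [|l' r'] /=.
  by have := (nleaves_gt0 l, nleaves_gt0 r) => -[]; lia.
move=> e.
have [kA hA] := extends_full A; have [kB hB] := extends_full B'.
pose W := full (maxn kA kB).
have WA t : extends A (graft t (nseq (nleaves t) W)) by apply: hA => //; exact: leq_maxl.
have WB t : extends B' (graft t (nseq (nleaves t) W)) by apply: hB => //; exact: leq_maxr.
(* One list must serve both trees, so its length depends only on the number of leaves. Its outer
   entries provide the carets on the two spines that the normal form needs. *)
pose ss := [:: N (N o W) W] ++ nseq (nleaves l + nleaves r).-2 W ++ [:: N W (N W (N W o))].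
have nf l1 r1 : nleaves l1 + nleaves r1 = nleaves l + nleaves r -> exists s b c,
    R (graft (N l1 r1) ss) (N (N o s) (N b (N c o))).
  move=> e1; have -> : ss = (N (N o W) W :: nseq (nleaves l1).-1 W) ++
      (nseq (nleaves r1).-1 W ++ [:: N W (N W (N W o))]).
    rewrite /ss -e1 [RHS]catA !cat_cons -nseqD; congr (_ :: nseq _ _ ++ _).
    by have := (nleaves_gt0 l1, nleaves_gt0 r1) => -[]; lia.
  rewrite graft_node; last by rewrite /= size_nseq; have := nleaves_gt0 l1; lia.
  have [a [s [-> ha _]]] := graft_left_spine l1 (WA o) WA.
  have [b [c [d [-> _ _ hd]]]] := graft_right_spine r1 (WB o) WB.
  exact: normal_form.
have [s [b [c h]]] := nf l r erefl; have [s' [b' [c' h']]] := nf l' r' (esym e).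
have szs : size ss = nleaves (N l r).
  by rewrite !size_cat size_nseq /=; have := (nleaves_gt0 l, nleaves_gt0 r) => -[]; lia.
apply: (cc_cancel RC szs) => //; apply: (trans h); apply: (trans _ (sym h')).
apply: shift_01_10_110.
have := cc_nleaves RC h; have := cc_nleaves RC h'; rewrite !nleaves_graft ?szs //.
by rewrite /=; lia.
Qed.
End Normalisation.

(** * Removing a leaf from a reduced diagram *)

(* Number of carets whose leftmost leaf is leaf [i], that is, the number of
   [Node]s immediately before leaf [i] in prefix notation. *)
Fixpoint left_carets (t : tree) (i : nat) : nat :=
  match t with
  | Leaf => 0
  | Node l r => if i < nleaves l then left_carets l i + (i == 0) else left_carets r (i - nleaves l)
  end.

Lemma left_carets_out t i : nleaves t <= i.+1 -> left_carets t i = 0.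
Proof.
elim: t i => [|l IHl r IHr] i //= h; have := (nleaves_gt0 l, nleaves_gt0 r) => -[pl pr].
by case: ltnP => hi; [lia | apply: IHr; lia].
Qed.

Lemma left_carets_gt0 t i : 0 < left_carets t i -> i.+1 < nleaves t.
Proof. by case: (leqP (nleaves t) i.+1) => // /left_carets_out ->. Qed.

Lemma left_carets_node0 l r : left_carets (Node l r) 0 = (left_carets l 0).+1.
Proof. by rewrite /= nleaves_gt0 addn1. Qed.

(** In prefix notation an exposed caret reads [Node Leaf Leaf], which two consecutive values of
    [left_carets] detect. *)
Lemma mem_exposed t o j :
  (j \in exposed t o) = [&& o <= j, 0 < left_carets t (j - o) & left_carets t (j - o).+1 == 0].
Proof.
elim: t o j => [|l IHl r IHr] o j; first by rewrite /= andbF.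
have [[-> ->]|nl] : (l = Leaf /\ r = Leaf) \/ (l <> Leaf \/ r <> Leaf).
  by case: (l) => [|? ?]; case: (r) => [|? ?]; [left|right; right|right; left|right; left].
  rewrite /= inE; case: (ltngtP j o) => [jo|jo|->]; rewrite ?subnn //=.
  by case: (j - o) (subn_gt0 o j) => [|k]; rewrite jo.
have -> : exposed (Node l r) o = exposed l o ++ exposed r (o + nleaves l).
  by case: (l) (r) nl => [|? ?] [|? ?] //= [].
rewrite mem_cat IHl IHr /=; have pl := nleaves_gt0 l.
case: (leqP o j) => [oj|jo] /=; last by have -> : (o + nleaves l <= j) = false by lia.
case: (ltngtP (j - o).+1 (nleaves l)) => h.
- have -> : (o + nleaves l <= j) = false by lia.
  rewrite !orbF; case: (posnP (j - o)) => [->|]; last by case: (j - o) => // k _; rewrite !addn0.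
  by case: l {IHl nl} h pl => [|l1 l2] // h pl; rewrite left_carets_node0 !addn0 addn1.
- have -> : o + nleaves l <= j by lia.
  rewrite left_carets_out /=; last by lia.
  by rewrite subnDA subSn //; lia.
have -> : (o + nleaves l <= j) = false by lia.
rewrite h subnn left_carets_out ?h //=; case: (posnP (j - o)) => [e|]; last by case: (j - o).
case: r {IHr} nl => [|r1 r2]; last by rewrite left_carets_node0.
by case: l {IHl pl} h => [|l1 l2] h; [case | move: (nleaves_gt0 l1) (nleaves_gt0 l2) h; rewrite e /=; lia].
Qed.

Definition exposed_at t j := (0 < left_carets t j) && (left_carets t j.+1 == 0).

Lemma reducedP d : reflect
  (carets d.1 = carets d.2 /\ forall j, exposed_at d.1 j -> exposed_at d.2 j -> False)
  (reduced d).
Proof.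
apply: (iffP andP) => -[e h]; split; [exact/eqP|move=> j h1 h2|exact/eqP|].
  move/hasPn: h => /(_ j); rewrite !mem_exposed !subn0 /= => /(_ h1) /negP; exact.
apply/hasPn => j; rewrite !mem_exposed !subn0 /= => h1; apply/negP => h2.
exact: h h1 h2.
Qed.

(** Mirror image of [left_carets t 0]. *)
Fixpoint rspine t := if t is Node _ r then (rspine r).+1 else 0.

Fixpoint del (i : nat) (t : tree) : tree :=
  match t with
  | Leaf => Leaf
  | Node l r =>
      if i < nleaves l then (if l is Leaf then r else Node (del i l) r)
      else (if r is Leaf then l else Node l (del (i - nleaves l) r))
  end.

Fixpoint left_leaf (t : tree) (i : nat) : bool :=
  match t with
  | Leaf => false
  | Node l r =>
      if i < nleaves l then (if l is Leaf then true else left_leaf l i)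
      else (if r is Leaf then false else left_leaf r (i - nleaves l))
  end.

(* Length of the spine of the sibling of leaf [i] on the side of leaf [i]. *)
Fixpoint sibling_spine (t : tree) (i : nat) : nat :=
  match t with
  | Leaf => 0
  | Node l r =>
      if i < nleaves l then (if l is Leaf then left_carets r 0 else sibling_spine l i)
      else (if r is Leaf then rspine l else sibling_spine r (i - nleaves l))
  end.

Lemma carets_del t i : i < nleaves t -> carets (del i t) = (carets t).-1.
Proof.
elim: t i => [|l IHl r IHr] i //= h; case: ltnP => hi.
  by case: l IHl hi h => [|l1 l2] IHl hi h //; rewrite [LHS]/= IHl //=; lia.
case: r IHr h => [|r1 r2] IHr h; first by rewrite addn0.
by rewrite [LHS]/= IHr /=; [lia | move: h => /=; lia].
Qed.

Lemma nleaves_del t i : t <> Leaf -> i < nleaves t -> nleaves (del i t) = (nleaves t).-1.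
Proof.
case: t => [|l r] // _ h; rewrite !nleaves_carets carets_del //=.
Qed.

(* In prefix notation, deleting a left leaf erases a factor [Node Leaf], while
   deleting a right leaf erases this leaf and a [Node] before leaf [s]. *)
Lemma left_carets_del t i : t <> Leaf -> i < nleaves t ->
  [/\ 0 < left_carets t i, left_leaf t i, sibling_spine t i = left_carets t i.+1 & forall k,
     left_carets (del i t) k = if k < i then left_carets t k
                      else if k == i then (left_carets t i + left_carets t i.+1).-1 else left_carets t k.+1]
  \/ left_carets t i = 0 /\ exists s, [/\ s < i,
     if s.+1 == i then 0 < left_carets t s else (1 < left_carets t s) && (left_carets t i.-1 == 0) & forall k,
     left_carets (del i t) k = if k < i then left_carets t k - (k == s) else left_carets t k.+1].
Proof.
elim: t i => [|l IHl r IHr] i // _ h; have := (nleaves_gt0 l, nleaves_gt0 r) => -[pl pr].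
case: (ltnP i (nleaves l)) => hi.
  have [el|nl] : l = Leaf \/ l <> Leaf by case: (l); [left|right].
    have -> : i = 0 by move: hi; rewrite el /=; lia.
    left; rewrite el /=; split=> // k.
    by case: k => [|k] //=; rewrite ?subSS ?subn0.
  have -> : del i (Node l r) = Node (del i l) r by rewrite /= hi; case: (l) nl.
  have -> : left_leaf (Node l r) i = left_leaf l i by rewrite /= hi; case: (l) nl.
  have -> : sibling_spine (Node l r) i = sibling_spine l i by rewrite /= hi; case: (l) nl.
  have nd := nleaves_del nl hi.
  have nl2 : 1 < nleaves l.
    by case: (l) nl => // l1 l2 _ /=; move: (nleaves_gt0 l1) (nleaves_gt0 l2); lia.
  case: (IHl i nl hi) => [[h1 h2 h3 h4]|[h1 [s [h2 h3 h4]]]].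
    have hi2 := left_carets_gt0 h1.
    left; split=> //=; rewrite ?hi ?hi2 ?addn_gt0 ?h1 ?h3 ?addn0 //.
    move=> k; rewrite nd h4.
    case: (ltngtP k i) => hk.
    - have -> : k < (nleaves l).-1 by lia.
      by have -> : k < nleaves l by lia.
    - case: ltnP => hk2.
        have -> : k.+1 < nleaves l by lia.
        by have -> : (k == 0) = false by lia.
      have -> : (k.+1 < nleaves l) = false by lia.
      by congr (left_carets r _); lia.
    - have -> : k < (nleaves l).-1 by lia.
      by subst k; lia.
  right; split.
    by rewrite /= hi h1; lia.
  exists s; split=> //.
    rewrite /=; have -> : s < nleaves l by lia.
    have -> : i.-1 < nleaves l by lia.
    move: h3; case: eqP => hs; first by lia.
    by move=> /andP[h5 /eqP h6]; rewrite h6; lia.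
  move=> k /=; rewrite nd h4.
  case: (ltnP k i) => hk.
    have -> : k < nleaves l by lia.
    case: ltnP => hk2; last by lia.
    have : k == s -> 0 < left_carets l k by move/eqP->; move: h3; case: eqP => _ //; lia.
    by case: (k == s) => [/(_ isT)|_]; lia.
  case: ltnP => hk2.
    have -> : k.+1 < nleaves l by lia.
    by lia.
  have -> : (k.+1 < nleaves l) = false by lia.
  by congr (left_carets r _); lia.
have [er|nr] : r = Leaf \/ r <> Leaf by case: (r); [left|right].
  have {hi} -> : i = nleaves l by move: h; rewrite er /=; lia.
  (* The erased caret is the root, whose leftmost leaf is 0; hence [s] is 0. *)
  right; rewrite er /= !ltnn; split=> //; exists 0; split=> //.
    rewrite pl prednK //; case: eqP => hs; first by lia.
    have : 0 < left_carets l 0 by case: (l) hs => // l1 l2 _; rewrite left_carets_node0.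
    by rewrite leqnn (left_carets_out (i := (nleaves l).-1)); lia.
  move=> k; case: ltnP => hk; first by lia.
  have -> : (k.+1 < nleaves l) = false by lia.
  by rewrite left_carets_out //; lia.
have hi' : i - nleaves l < nleaves r by move: h => /=; lia.
have nhi : (i < nleaves l) = false by lia.
have -> : del i (Node l r) = Node l (del (i - nleaves l) r).
  by rewrite /= nhi; case: (r) nr.
have -> : left_leaf (Node l r) i = left_leaf r (i - nleaves l).
  by rewrite /= nhi; case: (r) nr.
have -> : sibling_spine (Node l r) i = sibling_spine r (i - nleaves l).
  by rewrite /= nhi; case: (r) nr.
have nhi1 : (i.+1 < nleaves l) = false by lia.
case: (IHr _ nr hi') => [[h1 h2 h3 h4]|[h1 [s [h2 h3 h4]]]].
  left; rewrite /= nhi nhi1; split=> //; first by rewrite h3 subSn.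
  move=> k; rewrite h4; case: (ltnP k (nleaves l)) => hk.
    by have -> : k < i by lia.
  have -> : (k.+1 < nleaves l) = false by lia.
  have -> : (k - nleaves l < i - nleaves l) = (k < i) by lia.
  have -> : (k - nleaves l == i - nleaves l) = (k == i) by lia.
  by rewrite !subSn.
right; rewrite /= nhi; split=> //; exists (s + nleaves l); split; first by lia.
  have -> : (s + nleaves l < nleaves l) = false by lia.
  have -> : s + nleaves l - nleaves l = s by lia.
  have -> : ((s + nleaves l).+1 == i) = (s.+1 == i - nleaves l) by lia.
  move: h3; case: eqP => // hs; have -> : (i.-1 < nleaves l) = false by lia.
  by have -> : (i - nleaves l).-1 = i.-1 - nleaves l by lia.
move=> k; rewrite h4; case: (ltnP k (nleaves l)) => hk.
  have -> : k < i by lia.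
  have -> : (k == s + nleaves l) = false by lia.
  by rewrite subn0.
have -> : (k.+1 < nleaves l) = false by lia.
have -> : (k - nleaves l < i - nleaves l) = (k < i) by lia.
have -> : (k - nleaves l == s) = (k == s + nleaves l) by lia.
by rewrite !subSn.
Qed.

(* Leaves [j], [j+1], [j+2] form a subtree with two carets. *)
Definition triple_at t j :=
  (left_carets t j.+2 == 0) &&
  ((1 < left_carets t j) && (left_carets t j.+1 == 0) || (0 < left_carets t j) && (left_carets t j.+1 == 1)).

(** An old exposed caret survives, shifted if it lies to the right of leaf [i]. A new one arises
    only when a three-leaf subtree containing leaf [i] shrinks to a caret. *)
Lemma exposed_del t i j : t <> Leaf -> i < nleaves t -> exposed_at (del i t) j ->
  [\/ exposed_at t j /\ j.+1 < i, exposed_at t j.+1 /\ i <= j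
    | triple_at t j /\ j <= i <= j.+2].
Proof.
move=> nt hi; rewrite /exposed_at /triple_at.
case: (left_carets_del nt hi) => [[h1 _ _ h4]|[h1 [s [h2 h3 h4]]]]; rewrite !h4.
  have [ji|ji|ji] := ltngtP j.+1 i.
  - by move=> h; apply: Or31; split=> //; lia.
  - have [->|ne] := eqVneq j i.
      move=> h; case: (posnP (left_carets t i.+1)) => h5; first by apply: Or33; split; lia.
      by apply: Or32; split; lia.
    by move=> h; apply: Or32; split; lia.
  - by subst i; rewrite ?eqxx => h; apply: Or33; split; lia.
have [ji|ji|ji] := ltngtP j.+1 i.
- case: (eqVneq j.+1 s) => [es|ns]; last first.
    by move=> h; apply: Or31; split=> //; lia.
  subst s; move: h3; case: eqP => [ei|ni] h3 h; last by lia.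
  by subst i; apply: Or33; split; lia.
- by move=> h; apply: Or32; split=> //; lia.
- subst i => h; apply: Or33.
  have [es|ns] := eqVneq s j; first by subst s; split; lia.
  move: h3; have -> : (s.+1 == j.+1) = false by lia.
  by move=> h3; exfalso; move: h h3 => /=; lia.
Qed.

Lemma triple_nleaves t j : triple_at t j -> j.+2 < nleaves t.
Proof.
move=> tj; have [|h] := ltnP 0 (left_carets t j.+1); first by move/left_carets_gt0; lia.
have hj : 1 < left_carets t j by move: tj; rewrite /triple_at; lia.
have nt : t <> Leaf by case: (t) hj.
have l1 : j < nleaves t by have := @left_carets_gt0 t j; lia.
case: (left_carets_del nt l1) => [[_ _ _ h1]|]; last by lia.
by have := @left_carets_gt0 (del j t) j; rewrite h1 ltnn eqxx nleaves_del //; lia.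
Qed.

Lemma triple_excl t j j' : triple_at t j -> triple_at t j' -> j' < j + 3 -> j < j' + 3 -> j = j'.
Proof.
move=> h h' l l'.
have [//|[e|[e|[e|e]]]] : j = j' \/ (j' = j.+1 \/ j' = j.+2 \/ j = j'.+1 \/ j = j'.+2) by lia.
all: by subst; move: h h'; rewrite /triple_at; lia.
Qed.

(** * Deletions that keep a diagram reduced *)

Definition del_diag i (d : diagram) : diagram := (del i d.1, del i d.2).
Definition component (b : bool) (d : diagram) := if b then d.1 else d.2.

Definition common_triple (d : diagram) j := triple_at d.1 j && triple_at d.2 j.

Lemma common_triple_component b d j : common_triple d j -> triple_at (component b d) j.
Proof. by case/andP; case: b. Qed.

Lemma reduced_component d b j : reduced d ->
  exposed_at (component b d) j -> exposed_at (component (~~ b) d) j -> False.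
Proof. by move=> /reducedP[_ h]; case: b => h1 h2; apply: (h j). Qed.

Lemma nleaves_neq_leaf t : 1 < nleaves t -> t <> Leaf.
Proof. by case: t. Qed.

(** Both trees get an exposed caret at the same [j]. By [exposed_del] each is old or comes from a
    triple; two old ones contradict reducedness, and one old one forces leaf [i] to be an outer leaf
    of the triple. *)
Lemma not_deletable d i : reduced d -> 1 < nleaves d.1 -> i < nleaves d.1 ->
  ~~ reduced (del_diag i d) -> exists j, [\/ common_triple d j /\ j <= i <= j.+2,
    i = j.+2 /\ exists b, exposed_at (component b d) j /\ triple_at (component (~~ b) d) j
  | i = j /\ exists b, exposed_at (component b d) j.+1 /\ triple_at (component (~~ b) d) j].
Proof.
move=> rd n1 hi nr; have e := reduced_nleaves rd.
have [j h1 h2] : exists2 j, exposed_at (del i d.1) j & exposed_at (del i d.2) j.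
  case/nandP: nr => [|/negPn/hasP[j]].
    by rewrite /= !carets_del -?e //; move/reducedP: rd => [-> _]; rewrite eqxx.
  by rewrite !mem_exposed !subn0 /= => *; exists j.
exists j.
have nl1 := nleaves_neq_leaf n1; have nl2 : d.2 <> Leaf by apply: nleaves_neq_leaf; rewrite -e.
have hi2 : i < nleaves d.2 by rewrite -e.
have rc b k := @reduced_component d b k rd.
case: (exposed_del nl1 hi h1) => -[a1 b1]; case: (exposed_del nl2 hi2 h2) => -[a2 b2]; try lia.
- by case: (rc true j).
- by apply: Or32; split; [lia | exists true].
- by case: (rc true j.+1).
- by apply: Or33; split; [lia | exists true].
- by apply: Or32; split; [lia | exists false].
- by apply: Or33; split; [lia | exists false].
by apply: Or31; rewrite /common_triple a1 a2.
Qed.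

Lemma not_deletable_triple d i : reduced d -> 1 < nleaves d.1 -> i < nleaves d.1 ->
  ~~ reduced (del_diag i d) ->
  exists j b, j <= i <= j.+2 /\ triple_at (component b d) j.
Proof.
move=> rd n1 hi /(not_deletable rd n1 hi)[j h]; exists j; case: h.
- by move=> [/(common_triple_component true) ? ?]; exists true.
- by move=> [-> [b [_ ?]]]; exists (~~ b); split=> //; lia.
- by move=> [-> [b [_ ?]]]; exists (~~ b); split=> //; lia.
Qed.

Lemma triple_exposed_pred t j : triple_at t j.+1 -> ~~ exposed_at t j.
Proof. by rewrite /triple_at /exposed_at; lia. Qed.

Lemma triple_exposed_succ t j : triple_at t j -> ~~ exposed_at t j.+2.
Proof. by rewrite /triple_at /exposed_at; lia. Qed.

(** In the other cases of [not_deletable] the tree carrying this triple would also contain an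
    overlapping triple, or an exposed caret sharing just one leaf with it. *)
Lemma triple_center d b j : reduced d -> 1 < nleaves d.1 -> j.+1 < nleaves d.1 ->
  triple_at (component b d) j -> ~~ reduced (del_diag j.+1 d) -> common_triple d j.
Proof.
move=> rd n1 hj tj /(not_deletable rd n1 hj)[j2 [[ct h]|[e [b' [h1 h2]]]|[e [b' [h1 h2]]]]].
- by rewrite (triple_excl tj (common_triple_component b ct)) //; lia.
- have {}e : j = j2.+1 by lia.
  subst j; have [eb|nb] := eqVneq b' b.
    by subst b'; move: (triple_exposed_pred tj); rewrite h1.
  have eb : ~~ b' = b by case: b b' nb {tj h1 h2} => -[].
  by rewrite eb in h2; have := triple_excl tj h2; lia.
- subst j2; have [eb|nb] := eqVneq b' b.
    by subst b'; move: (triple_exposed_succ tj); rewrite h1.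
  have eb : ~~ b' = b by case: b b' nb {tj h1 h2} => -[].
  by rewrite eb in h2; have := triple_excl tj h2; lia.
Qed.

(** Two deletions at [j] contract the triple to one leaf and erase its two carets. *)
Lemma left_carets_collapse t j k : triple_at t j -> left_carets (del j (del j t)) k =
  if k < j then left_carets t k else if k == j then left_carets t j + left_carets t j.+1 - 2 else left_carets t k.+2.
Proof.
rewrite /triple_at => tj.
have hj : 0 < left_carets t j by lia.
have n1 := left_carets_gt0 hj; have nt : t <> Leaf by case: (t) n1.
case: (left_carets_del nt (ltnW n1)) => [[_ _ _ h1]|]; last by lia.
have hj1 : 0 < left_carets (del j t) j by rewrite h1 ltnn eqxx; lia.
have n1' := left_carets_gt0 hj1; have nt1 : del j t <> Leaf by case: (del j t) n1'.
case: (left_carets_del nt1 (ltnW n1')) => [[_ _ _ h2]|]; last by lia.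
rewrite h2 !h1; case: (ltngtP k j) => // h; rewrite ?ltnn ?eqxx.
- have -> : (k.+1 < j) = false by lia.
  by have -> : (k.+1 == j) = false by lia.
have -> : (j.+1 < j) = false by lia.
have -> : (j.+1 == j) = false by lia.
by lia.
Qed.

Lemma carets_collapse t j : j.+2 < nleaves t -> carets (del j (del j t)) = (carets t).-2.
Proof.
move=> h; have nt : t <> Leaf by apply: nleaves_neq_leaf; lia.
by rewrite !carets_del ?nleaves_del //; lia.
Qed.

(** If collapsing fails, the collapsed leaf lies in a common exposed caret, so leaf [j+3] or leaf
    [j-1] is the sibling of the triple in both trees. That leaf can be deleted, since a triple
    blocking it would overlap the one at [j] or contradict the value of [left_carets] there. *)
Lemma common_triple_collapse d j : reduced d -> common_triple d j ->
  [\/ reduced (del_diag j (del_diag j d)),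
      j.+3 < nleaves d.1 /\ reduced (del_diag j.+3 d)
    | 0 < j /\ reduced (del_diag j.-1 d)].
Proof.
move=> rd ct; have e := reduced_nleaves rd.
have t1 : triple_at d.1 j by exact: common_triple_component true _ _ ct.
have t2 : triple_at d.2 j by exact: common_triple_component false _ _ ct.
have hj := triple_nleaves t1.
have n1 : 1 < nleaves d.1 by lia.
case: (boolP (reduced (del_diag j (del_diag j d)))) => [|nr]; first by move=> ?; apply: Or31.
have [k h1 h2] : exists2 k, exposed_at (del j (del j d.1)) k & exposed_at (del j (del j d.2)) k.
  case/nandP: nr => [|/negPn/hasP[k]].
    by rewrite /= !carets_collapse -?e //; move/reducedP: rd => [-> _]; rewrite eqxx.
  by rewrite !mem_exposed !subn0 /= => *; exists k.
have rc := @reduced_component d true _ rd.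
move: h1 h2; rewrite /exposed_at !left_carets_collapse // => h1 h2.
have [kj|kj|kj] := ltngtP k.+1 j.
- exfalso; move: h1 h2.
  by have [-> ->] : k < j /\ k.+1 < j; [lia | exact: rc].
- have [ek|nk] := eqVneq k j; last first.
    exfalso; move: h1 h2.
    have [-> ->] : (k < j) = false /\ (k.+1 < j) = false by lia.
    have [-> ->] : (k == j) = false /\ (k.+1 == j) = false by lia.
    exact: rc.
  subst k; move: h1 h2; rewrite ltnn eqxx.
  have -> : (j.+1 < j) = false by lia.
  have -> : (j.+1 == j) = false by lia.
  move=> /andP[h1 /eqP z1] /andP[_ /eqP z2].
  have l3 : j.+3 < nleaves d.1.
    have := @left_carets_gt0 (del j (del j d.1)) j; rewrite left_carets_collapse // ltnn eqxx => /(_ h1).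
    by rewrite nleaves_carets carets_collapse // nleaves_carets; lia.
  apply: Or32; split=> //; apply/negPn/negP => /(not_deletable_triple rd n1 l3)[j3 [b [hj3 t3]]].
  have tb : triple_at (component b d) j by exact: common_triple_component.
  have zb : left_carets (component b d) j.+3 = 0 by case: (b).
  have [ej|nj] := eqVneq j3 j.+3; first by subst j3; move: t3; rewrite /triple_at zb; lia.
  by have := triple_excl tb t3; lia.
- have {}kj : j = k.+1 by lia.
  subst j; apply: Or33; split=> //=; apply/negPn/negP => /(not_deletable_triple rd n1)[|j3 [b [hj3 t3]]].
    by lia.
  have tb : triple_at (component b d) k.+1 by exact: common_triple_component.
  move: h1 h2; rewrite ltnSn => /andP[h1 _] /andP[h2 _].
  have zb : 0 < left_carets (component b d) k by case: (b).
  have [ej|nj] := eqVneq k j3.+2; first by subst k; move: t3; rewrite /triple_at; lia.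
  by have := triple_excl tb t3; lia.
Qed.

Definition shrinkable d i :=
  reduced (del_diag i d) || common_triple d i && reduced (del_diag i (del_diag i d)).

(** If leaf [i] is blocked by a triple at [j], try its middle leaf; if this is blocked too, the
    triple is common and one of [j], [j+3], [j-1] works. As [j] lies between [i-2] and [i], seven
    leaves suffice. *)
Lemma shrinkable_window d i : reduced d -> i.+3 < nleaves d.1 -> 2 < i ->
  exists2 i', i - 3 <= i' <= i + 3 & shrinkable d i'.
Proof.
move=> rd hi i2; rewrite /shrinkable.
have n1 : 1 < nleaves d.1 by lia.
have [h|/(not_deletable_triple rd n1)[|j [b [hj tj]]]] := boolP (reduced (del_diag i d)).
- by exists i; rewrite ?h //; lia.
- by lia.
have [h|nr] := boolP (reduced (del_diag j.+1 d)).
  by exists j.+1; rewrite ?h //; lia.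
have ct : common_triple d j by apply: triple_center tj nr => //; lia.
have [h|[_ h]|[_ h]] := common_triple_collapse rd ct.
- by exists j; [lia | rewrite ct h orbT].
- by exists j.+3; rewrite ?h //; lia.
- by exists j.-1; rewrite ?h //; lia.
Qed.

(** * Recovering a tree from a deletion *)

Lemma left_leaf_first t : t <> Leaf -> left_leaf t 0.
Proof.
elim: t => // l IH r _ _; rewrite /= nleaves_gt0.
by case: l IH => // l1 l2 IH; apply: IH.
Qed.

Lemma left_leaf_last t : t <> Leaf -> left_leaf t (nleaves t).-1 = false.
Proof.
elim: t => // l _ r IH _ /=; have := (nleaves_gt0 l, nleaves_gt0 r) => -[pl pr].
have -> : ((nleaves l + nleaves r).-1 < nleaves l) = false by lia.
have -> : (nleaves l + nleaves r).-1 - nleaves l = (nleaves r).-1 by lia.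
by case: r IH {pr} => // r1 r2 IH; apply: IH.
Qed.

Lemma sibling_spine_first t : t <> Leaf -> sibling_spine t 0 <= left_carets (del 0 t) 0.
Proof.
elim: t => // l IH r _ _; have pl := nleaves_gt0 l; rewrite [sibling_spine _ _]/= [del _ _]/= pl.
by case: l IH {pl} => // l1 l2 /(_ _)/leq_trans->//; rewrite left_carets_node0.
Qed.

Lemma sibling_spine_last t : t <> Leaf -> sibling_spine t (nleaves t).-1 <= rspine (del (nleaves t).-1 t).
Proof.
elim: t => // l _ r IH _; have := (nleaves_gt0 l, nleaves_gt0 r) => -[pl pr].
rewrite [sibling_spine _ _]/= [del _ _]/=.
have -> : ((nleaves l + nleaves r).-1 < nleaves l) = false by lia.
have -> : (nleaves l + nleaves r).-1 - nleaves l = (nleaves r).-1 by lia.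
by case: r IH {pr} => // r1 r2 IH; apply: leq_trans (IH _) _ => //=.
Qed.

Variant del_spec l r i : tree -> bool -> nat -> Prop :=
| DelLeft of l = Leaf & i = 0 : del_spec l r i r true (left_carets r 0)
| DelInLeft of l <> Leaf & i < nleaves l :
    del_spec l r i (Node (del i l) r) (left_leaf l i) (sibling_spine l i)
| DelRight of r = Leaf & i = nleaves l : del_spec l r i l false (rspine l)
| DelInRight of r <> Leaf & nleaves l <= i & i - nleaves l < nleaves r :
    del_spec l r i (Node l (del (i - nleaves l) r))
      (left_leaf r (i - nleaves l)) (sibling_spine r (i - nleaves l)).

Lemma delP l r i : i < nleaves (Node l r) ->
  del_spec l r i (del i (Node l r)) (left_leaf (Node l r) i) (sibling_spine (Node l r) i).
Proof.
move=> /=; case: (ltnP i (nleaves l)) => h hi.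
  case: l h hi => [|l1 l2] h hi; first by apply: DelLeft => //; move: h => /=; lia.
  by apply: DelInLeft.
case: r hi => [|r1 r2] hi; first by apply: DelRight => //; move: hi => /=; lia.
by apply: DelInRight => //; move: hi => /=; lia.
Qed.

(** The sibling of a deleted left leaf is a subtree of [del i t] starting at leaf [i]; for a right
    leaf it ends just before [i]. Such subtrees are nested, so the spine length singles one out. *)
Lemma del_inj i t1 t2 : t1 <> Leaf -> t2 <> Leaf -> i < nleaves t1 -> i < nleaves t2 ->
  del i t1 = del i t2 -> left_leaf t1 i = left_leaf t2 i -> sibling_spine t1 i = sibling_spine t2 i -> t1 = t2.
Proof.
elim: t1 t2 i => // l1 IHl r1 IHr [|l2 r2] i // _ _ h1 h2.
(* Mismatched cases of [del_spec], numbered by constructor: [C12] and [C34] contradict the spine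
   lengths, [C23] the leaf counts, [C24] the sides. *)
have C12 l r l' r' : l' <> Leaf -> r = Node (del 0 l') r' -> left_carets r 0 = sibling_spine l' 0 ->
    Node l r = Node l' r'.
  by move=> /sibling_spine_first h -> ; rewrite left_carets_node0; lia.
have C23 l l' r : i < nleaves l -> i = nleaves l' -> l <> Leaf ->
    Node (del i l) r = l' -> False.
  move=> hl hi nl e; move: hi; rewrite -e /= nleaves_del //.
  by have := nleaves_gt0 r; lia.
have C24 l r l' r' : l <> Leaf -> i < nleaves l -> r' <> Leaf -> nleaves l' <= i ->
    Node (del i l) r = Node l' (del (i - nleaves l') r') ->
    left_leaf l i = left_leaf r' (i - nleaves l') -> False.
  move=> nl hl nr hi [e _]; have := nleaves_del nl hl; rewrite e => e'.
  have -> : i - nleaves l' = 0 by lia.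
  have -> : i = (nleaves l).-1 by lia.
  by rewrite left_leaf_first // left_leaf_last.
have C34 l l' r' : r' <> Leaf -> i = nleaves l -> i - nleaves l' < nleaves r' ->
    l = Node l' (del (i - nleaves l') r') -> rspine l = sibling_spine r' (i - nleaves l') -> False.
  move=> nr hi hr e; have := nleaves_del nr hr; move: (hi); rewrite e /= => hi' e'.
  have -> : i - nleaves l' = (nleaves r').-1 by have := nleaves_gt0 r'; lia.
  by have := sibling_spine_last nr; lia.
have [p2 p1] := (nleaves_gt0 l2, nleaves_gt0 l1).
case: (delP h1) => [e1 i1|n1 i1|e1 i1|n1 i1 i1']; case: (delP h2) => [e2 i2|n2 i2|e2 i2|n2 i2 i2'] //.
- by rewrite e1 e2 => ->.
- by subst i => e _ a; apply: C12 a.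
- by lia.
- by subst i => e _ a; apply/esym; apply: C12 (esym a).
- by case=> e -> hl ha; rewrite (IHl l2 i).
- by move=> e; case: (C23 l1 l2 r1).
- by move=> e hl; case: (C24 l1 r1 l2 r2).
- by move=> e; case: (C23 l2 l1 r2).
- by rewrite e1 e2 => ->.
- by move=> e _ a; case: (C34 l1 l2 r2).
- by lia.
- by move=> e hl; case: (C24 l2 r2 l1 r1).
- by move=> e _ a; case: (C34 l2 l1 r1).
case=> el er hl ha; subst l2; congr Node.
exact: (IHr _ (i - nleaves l1)).
Qed.

(** * Averaging over the leaves *)

(** The boundary terms make the induction close: the inner spine of a child pays when the other
    child is a leaf, and the root adds one to each outer spine. *)
Lemma sum_sibling_spine t : \sum_(0 <= i < nleaves t) sibling_spine t i + left_carets t 0 + rspine t <= 2 * carets t.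
Proof.
elim: t => [|l IHl r IHr]; first by rewrite /= big_nat1.
have := (nleaves_gt0 l, nleaves_gt0 r) => -[pl pr].
have -> : \sum_(0 <= i < nleaves (Node l r)) sibling_spine (Node l r) i =
  (if l is Leaf then left_carets r 0 else \sum_(0 <= i < nleaves l) sibling_spine l i) +
  (if r is Leaf then rspine l else \sum_(0 <= i < nleaves r) sibling_spine r i).
  rewrite [nleaves _]/= (big_cat_nat (n := nleaves l)) ?leq_addr //=; congr addn.
    case: l {IHl pl} => [|l1 l2]; first by rewrite big_nat1.
    by apply: eq_big_nat => i /andP[_ ->].
  rewrite -{1}[nleaves l]add0n big_addn addKn.
  have E i : (if i + nleaves l < nleaves l then if l is Leaf then left_carets r 0 else sibling_spine l (i + nleaves l)
     else if r is Leaf then rspine l else sibling_spine r (i + nleaves l - nleaves l)) =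
     if r is Leaf then rspine l else sibling_spine r i.
    by rewrite ltnNge leq_addl /= addnK.
  under eq_bigr do rewrite E.
  by case: r {IHr pr E} => [|r1 r2] //; rewrite /= big_nat1.
rewrite left_carets_node0 /= ; case: l IHl {pl} => [|l1 l2]; case: r IHr {pr} => [|r1 r2] /=; lia.
Qed.

(** Markov's inequality. *)
Lemma count_leq_sum (f : nat -> nat) m s :
  m * count (fun i => m <= f i) s <= \sum_(i <- s) f i.
Proof.
elim: s => [|i s IH]; rewrite ?big_nil ?big_cons /= ?muln0 // mulnDr leq_add //.
by case: (leqP m (f i)) => h; rewrite ?muln1 ?muln0.
Qed.

Lemma count_blocks (P : pred nat) m : (forall b, b < m -> has P (iota (7 * b) 7)) ->
  m <= count P (iota 0 (7 * m)).
Proof.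
elim: m => // m IH h; rewrite mulnS addnC iotaD count_cat add0n -addn1 leq_add //.
  by apply: IH => b hb; apply: h; lia.
by rewrite -has_count h.
Qed.

Lemma count_cover (P Q1 Q2 Q3 Q4 : pred nat) s :
  (forall i, P i -> [|| Q1 i, Q2 i, Q3 i | Q4 i]) ->
  count P s <= count Q1 s + count Q2 s + count Q3 s + count Q4 s.
Proof. by move=> h; elim: s => //= i s IH; have := h i; lia. Qed.

(* Large enough to discard at most one leaf in 42 in each tree, whereas at least
   one leaf in seven is shrinkable. *)
Definition spine_bound := 83.

Definition deletable d i :=
  [&& reduced (del_diag i d), sibling_spine d.1 i <= spine_bound & sibling_spine d.2 i <= spine_bound].
Definition collapsible d i :=
  common_triple d i && reduced (del_diag i (del_diag i d)).

Lemma count_shrinkable d : reduced d -> 11 <= carets d.1 ->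
  (carets d.1).+1 <= 42 * (count (deletable d) (iota 0 (nleaves d.1)) +
                           count (collapsible d) (iota 0 (nleaves d.1))).
Proof.
move=> rd h11; have e := reduced_nleaves rd; set n := nleaves d.1.
have en : n = (carets d.1).+1 by exact: nleaves_carets.
have ec : carets d.2 = carets d.1 by case/reducedP: rd.
have bad t : nleaves t = n ->
    42 * count (fun i => spine_bound < sibling_spine t i) (iota 0 n) <= carets t.
  move=> et; have := count_leq_sum (sibling_spine t) spine_bound.+1 (iota 0 n).
  have := sum_sibling_spine t; rewrite et /index_iota subn0 /spine_bound; lia.
have b1 := bad d.1 erefl; have b2 := bad d.2 (esym e).
have h : n %/ 7 <= count (shrinkable d) (iota 0 n).
  have le7 : 7 * (n %/ 7) <= n by rewrite mulnC leq_divM.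
  apply: (@leq_trans (count (shrinkable d) (iota 0 (7 * (n %/ 7))))).
    apply: count_blocks => b hb; have hb7 : 7 * b + 7 <= n by lia.
    have [||i' hi' si'] := @shrinkable_window d (7 * b + 3) rd; try lia.
    by apply/hasP; exists i' => //; rewrite mem_iota; lia.
  by rewrite -[in X in _ <= X](subnKC le7) iotaD count_cat leq_addr.
have := @count_cover (shrinkable d) (deletable d) (collapsible d)
  (fun i => spine_bound < sibling_spine d.1 i) (fun i => spine_bound < sibling_spine d.2 i) (iota 0 n).
have c i : shrinkable d i -> [|| deletable d i, collapsible d i,
    spine_bound < sibling_spine d.1 i | spine_bound < sibling_spine d.2 i].
  rewrite /shrinkable /deletable /collapsible.
  case: (reduced (del_diag i d)) => /= [_|->//].
  by rewrite !ltnNge; case: (_ <= _) => /=; case: (_ <= _); rewrite ?orbT.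
(* Here 42 (n / 7) is at least 6n - 36 and the long spines cost at most 2(n - 1), which leaves 4n -
   34. This is at least n because n >= 12. *)
move=> /(_ c) {c}; rewrite -/n; lia.
Qed.

(** * Growth of the number of reduced diagrams *)

(** The bound is on the height, which is at most the number of carets. *)
Fixpoint trees_le n : seq tree :=
  if n is n'.+1 then Leaf :: [seq Node l r | l <- trees_le n', r <- trees_le n']
  else [:: Leaf].

Lemma mem_trees_le n t : carets t <= n -> t \in trees_le n.
Proof.
elim: n t => [|n IH] [|l r] //= h; rewrite inE; apply/orP; right.
by apply/allpairsP; exists (l, r); split=> //=; apply: IH; lia.
Qed.

Definition diagrams n : seq diagram :=
  [seq d <- undup [seq (t, u) | t <- trees_le n, u <- trees_le n]
   | reduced d && (carets d.1 == n)].

Lemma diagrams_uniq n : uniq (diagrams n).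
Proof. by rewrite filter_uniq ?undup_uniq. Qed.

Lemma mem_diagrams n d : (d \in diagrams n) = reduced d && (carets d.1 == n).
Proof.
rewrite mem_filter mem_undup; case: d => t u /=; case rd: (reduced _ && _) => //=.
case/andP: rd => /reducedP[/= e _] /eqP h.
by apply/allpairsP; exists (t, u); split=> //=; apply: mem_trees_le; rewrite -?e h.
Qed.

Definition nb_diagrams n := size (diagrams n).

Definition codes := [seq (b, a) | b <- [:: true; false], a <- iota 0 spine_bound.+1].
Definition code t i := (left_leaf t i, sibling_spine t i).

Lemma mem_codes t i : (code t i \in codes) = (sibling_spine t i <= spine_bound).
Proof.
apply/allpairsP/idP => [[[b a] []]|h].
  by move=> _; rewrite mem_iota => h [_ ->].
exists (code t i); split; [by case: (code t i) => -[] | by rewrite mem_iota | by []].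
Qed.

(** Double counting: the pairs of a diagram and an admissible leaf are encoded injectively in
    [tgt]. *)
Lemma size_pairs_le (s : seq diagram) (P : diagram -> pred nat) n (T : eqType)
    (enc : diagram -> nat -> T) (tgt : seq T) :
  uniq s ->
  (forall d i d' i', d \in s -> d' \in s -> i < n -> i' < n -> P d i -> P d' i' ->
     enc d i = enc d' i' -> d = d' /\ i = i') ->
  (forall d i, d \in s -> i < n -> P d i -> enc d i \in tgt) ->
  \sum_(d <- s) count (P d) (iota 0 n) <= size tgt.
Proof.
move=> us inj sub.
pose L := [seq (d, i) | d <- s, i <- [seq i <- iota 0 n | P d i]].
have sL : size L = \sum_(d <- s) count (P d) (iota 0 n).
  rewrite size_allpairs_dep sumnE big_map; apply: eq_bigr => d _; exact: size_filter.
have mL p : p \in L -> [/\ p.1 \in s, p.2 < n & P p.1 p.2].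
  by case/allpairsPdep => d [i [hd]]; rewrite mem_filter mem_iota add0n => /and3P[h1 _ h2] ->.
have uL : uniq L.
  apply: allpairs_uniq_dep => // [d _|[d i] [d' i'] _ _ [-> ->] //].
  by rewrite filter_uniq ?iota_uniq.
rewrite -sL -(size_map (fun p => enc p.1 p.2)); apply: uniq_leq_size.
  rewrite map_inj_in_uniq // => -[d i] [d' i'] /mL[h1 h2 h3] /mL[h1' h2' h3'] e.
  by have /= [-> ->] := inj _ _ _ _ h1 h1' h2 h2' h3 h3' e.
by move=> x /mapP[p /mL[h1 h2 h3] ->]; apply: sub.
Qed.

Definition encode1 d i := (del_diag i d, i, code d.1 i, code d.2 i).

Lemma encode1_inj d d' i i' : carets d.1 = carets d.2 -> carets d'.1 = carets d'.2 ->
  carets d.1 = carets d'.1 ->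
  0 < carets d.1 -> i < nleaves d.1 -> encode1 d i = encode1 d' i' -> d = d' /\ i = i'.
Proof.
move=> rd rd' ec c0 hi.
have e : nleaves d.1 = nleaves d.2 by rewrite !nleaves_carets rd.
have e' : nleaves d'.1 = nleaves d'.2 by rewrite !nleaves_carets rd'.
have en : nleaves d'.1 = nleaves d.1 by rewrite !nleaves_carets ec.
have nl t : nleaves t = nleaves d.1 -> t <> Leaf.
  by rewrite !nleaves_carets => h; apply: nleaves_neq_leaf; rewrite nleaves_carets; lia.
case=> e1 e2 ei a1 b1 a2 b2; subst i'; split=> //.
case: d d' {rd rd'} e e' en ec c0 hi nl e1 e2 a1 b1 a2 b2 => t u [t' u'] /=.
move=> e e' en ec c0 hi nl e1 e2 a1 b1 a2 b2; congr pair.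
  by apply: (@del_inj i) => //; rewrite ?en //; apply: nl.
by apply: (@del_inj i) => //; rewrite -?e -?e' ?en //; apply: nl; rewrite -?e -?e' ?en.
Qed.

Lemma count_deletable n :
  \sum_(d <- diagrams n.+1) count (deletable d) (iota 0 n.+2) <=
  nb_diagrams n * (n.+2 * size codes ^ 2).
Proof.
pose tgt := [seq (x, c2) | x <- [seq (x, c1) | x <- [seq (d, i) | d <- diagrams n,
  i <- iota 0 n.+2], c1 <- codes], c2 <- codes].
have -> : nb_diagrams n * (n.+2 * size codes ^ 2) = size tgt.
  by rewrite /tgt; move: codes => cs; rewrite !size_allpairs size_iota expnS expn1 !mulnA.
apply: (size_pairs_le (enc := encode1)); first exact: diagrams_uniq.
  move=> d i d' i'; rewrite !mem_diagrams.
  move=> /andP[/reducedP[rd _] /eqP cd] /andP[/reducedP[rd' _] /eqP cd'] hi _ _ _.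
  by apply: encode1_inj; rewrite -?rd -?rd' ?nleaves_carets ?cd ?cd'.
move=> d i; rewrite mem_diagrams => /andP[rd /eqP cd] hi /and3P[h1 h2 h3].
apply: allpairs_f; last by rewrite mem_codes.
apply: allpairs_f; last by rewrite mem_codes.
apply: allpairs_f; last by rewrite mem_iota.
by rewrite mem_diagrams h1 /= carets_del ?nleaves_carets cd.
Qed.

Definition encode2 d i :=
  (encode1 (del_diag i d) i, code d.1 i, code d.2 i).

(** In a triple the sibling of leaf [i] has at most one caret, so the codes of both deletions of a
    collapse lie in [codes]. *)
Lemma triple_sibling_spine t i : triple_at t i ->
  sibling_spine t i <= spine_bound /\ sibling_spine (del i t) i <= spine_bound.
Proof.
rewrite /triple_at => h; have h0 : 0 < left_carets t i by lia.
have n1 := left_carets_gt0 h0; have nt : t <> Leaf by case: (t) n1.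
case: (left_carets_del nt (ltnW n1)) => [[_ _ -> h1]|]; last by lia.
have h2 : 0 < left_carets (del i t) i by rewrite h1 ltnn eqxx; lia.
have n2 := left_carets_gt0 h2; have nt2 : del i t <> Leaf by case: (del i t) n2.
case: (left_carets_del nt2 (ltnW n2)) => [[_ _ -> _]|]; last by lia.
rewrite h1; have -> : (i.+1 < i) = false by lia.
have -> : (i.+1 == i) = false by lia.
by rewrite /spine_bound; lia.
Qed.

Lemma count_collapsible n :
  \sum_(d <- diagrams n.+2) count (collapsible d) (iota 0 n.+3) <=
  nb_diagrams n * (n.+3 * size codes ^ 4).
Proof.
pose tgt := [seq (x, c4) | x <- [seq (x, c3) | x <- [seq (x, c2) | x <-
  [seq (x, c1) | x <- [seq (d, i) | d <- diagrams n,
  i <- iota 0 n.+3], c1 <- codes], c2 <- codes], c3 <- codes], c4 <- codes].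
have -> : nb_diagrams n * (n.+3 * size codes ^ 4) = size tgt.
  by rewrite /tgt; move: codes => cs; rewrite !size_allpairs size_iota !expnS expn0 muln1 !mulnA.
apply: (size_pairs_le (enc := encode2)); first exact: diagrams_uniq.
  move=> d i d' i'; rewrite !mem_diagrams.
  move=> /andP[/reducedP[rd _] /eqP cd] /andP[/reducedP[rd' _] /eqP cd'] hi hi' ct ct' E.
  have ei : i = i' by case: E.
  (* Undo the two deletions in turn: the inner encoding gives the once-deleted diagrams, the outer
     codes the original ones. *)
  subst i'; suff e1 : encode1 d i = encode1 d' i.
    by apply: encode1_inj e1; rewrite -?rd -?rd' ?nleaves_carets ?cd ?cd'.
  have E1 := congr1 (fun x => x.1.1) E; have E2 := congr1 (fun x => x.1.2) E.
  have E3 := congr1 snd E; rewrite /= in E1 E2 E3.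
  have [h _] : del_diag i d = del_diag i d' /\ i = i.
    have tr : triple_at d.1 i by case/andP: ct => /andP[].
    apply: encode1_inj E1; rewrite /= ?nleaves_carets ?carets_del ?nleaves_carets;
      rewrite -?rd -?rd' ?cd ?cd' //.
    by have := triple_nleaves tr; rewrite nleaves_carets cd; lia.
  by rewrite /encode1 E2 E3 h.
move=> d i; rewrite mem_diagrams => /andP[rd /eqP cd] hi /andP[ct h1].
have [t1 t2] : triple_at d.1 i /\ triple_at d.2 i by move/andP: ct.
have [[a1 b1] [a2 b2]] := (triple_sibling_spine t1, triple_sibling_spine t2).
apply: allpairs_f; last by rewrite mem_codes.
apply: allpairs_f; last by rewrite mem_codes.
apply: allpairs_f; last by rewrite mem_codes.
apply: allpairs_f; last by rewrite mem_codes.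
apply: allpairs_f; last by rewrite mem_iota.
by rewrite mem_diagrams h1 /= carets_collapse ?cd // triple_nleaves.
Qed.

Lemma size_mul_le_sum (T : eqType) (s : seq T) (F : T -> nat) c :
  {in s, forall x, c <= F x} -> size s * c <= \sum_(x <- s) F x.
Proof.
elim: s => [|x s IH] h; rewrite ?big_nil ?big_cons // mulSn leq_add ?h ?mem_head //.
by apply: IH => y hy; rewrite h // inE hy orbT.
Qed.

(** By [count_shrinkable] each diagram has at least (n + 3) / 42 admissible leaves, while
    [count_deletable] and [count_collapsible] bound the number of pairs from above. *)
Lemma nb_diagrams_le_sum n : 9 <= n ->
  nb_diagrams n.+2 <= 42 * size codes ^ 4 * (nb_diagrams n.+1 + nb_diagrams n).
Proof.
move=> hn; rewrite -(leq_pmul2r (ltn0Sn n.+2)).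
have h : nb_diagrams n.+2 * n.+3 <=
    42 * (\sum_(d <- diagrams n.+2) count (deletable d) (iota 0 n.+3) +
          \sum_(d <- diagrams n.+2) count (collapsible d) (iota 0 n.+3)).
  rewrite -big_split big_distrr /=; apply: size_mul_le_sum => d.
  rewrite mem_diagrams => /andP[rd /eqP cd].
  by have := count_shrinkable rd; rewrite nleaves_carets cd; apply; lia.
apply: (leq_trans h) => {h}.
apply: leq_trans (leq_mul (leqnn 42) (leq_add (count_deletable n.+1) (count_collapsible n))) _.
have : size codes ^ 2 <= size codes ^ 4 by rewrite leq_pexp2l.
move: (size codes ^ 2) (size codes ^ 4) (nb_diagrams n.+1) (nb_diagrams n) (n.+3).
move=> c2 c4 a b m /(leq_mul (leqnn (a * m))) le.
have -> : a * (m * c2) = a * m * c2 by ring.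
have -> : 42 * c4 * (a + b) * m = 42 * (a * m * c4 + b * (m * c4)) by ring.
by rewrite leq_mul2l leq_add2r le orbT.
Qed.

(** Adding a last leaf under a new root of both trees is injective and exposes no new caret when the
    trees are nontrivial. *)
Lemma nb_diagrams_mono n : 0 < n -> nb_diagrams n <= nb_diagrams n.+1.
Proof.
move=> n0; rewrite /nb_diagrams -(size_map (fun d => (Node d.1 Leaf, Node d.2 Leaf)) (diagrams n)).
apply: uniq_leq_size.
  by rewrite map_inj_uniq ?diagrams_uniq // => -[t u] [t' u'] [-> ->].
move=> x /mapP[d hd ->]; move: hd; rewrite !mem_diagrams => /andP[/reducedP[e h] /eqP c].
apply/andP; split; last by rewrite /= c addn0.
have left_caretsN t j : left_carets (Node t Leaf) j = left_carets t j + (j == 0).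
  rewrite /=; case: ltnP => // hj; rewrite left_carets_out; last by lia.
  by have := nleaves_gt0 t; lia.
have ex t j : 0 < carets t -> exposed_at (Node t Leaf) j -> exposed_at t j.
  rewrite /exposed_at !left_caretsN addn0 => ht /andP[h1 ->]; rewrite andbT.
  by case: j h1 => [|j]; [case: t ht => // t1 t2 _ _; rewrite left_carets_node0 | rewrite addn0].
by apply/reducedP; split=> [|j /ex h1 /ex h2] /=; [rewrite e | apply: (h j); [apply: h1|apply: h2]; rewrite -?e c].
Qed.

Lemma nb_diagrams_monoW m n : 0 < m -> m <= n -> nb_diagrams m <= nb_diagrams n.
Proof.
move=> m0 /subnK<-; elim: (n - m) => // k IH.
by apply: leq_trans IH _; rewrite addSn nb_diagrams_mono //; lia.
Qed.

Lemma nb_diagrams_gt0 n : n != 1 -> 0 < nb_diagrams n.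
Proof.
have mem d m : d \in diagrams m -> 0 < nb_diagrams m by rewrite /nb_diagrams; case: diagrams.
case: n => [|[|n]] // _.
apply: (@leq_trans (nb_diagrams 2)); last by apply: nb_diagrams_monoW.
by apply: (mem (Node (Node Leaf Leaf) Leaf, Node Leaf (Node Leaf Leaf))); rewrite mem_diagrams.
Qed.

Lemma nb_diagrams_ratio :
  exists C, forall n, 2 <= n -> nb_diagrams n.+1 <= C * nb_diagrams n.
Proof.
(* [c] covers the finitely many small n and [M] is the factor of the recurrence; both large
   constants are kept abstract. *)
have [c hc] : exists c, nb_diagrams 10 <= c by exists (nb_diagrams 10); exact: leqnn.
have [M hM] : exists M, 42 * size codes ^ 4 = M by exists (42 * size codes ^ 4); reflexivity.
exists (2 * M + c) => n n2; rewrite mulnDl.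
have pn : 0 < nb_diagrams n by apply: nb_diagrams_gt0; lia.
case: (leqP n 9) => hn.
  have h10 : nb_diagrams n.+1 <= c := leq_trans (@nb_diagrams_monoW n.+1 10 (ltn0Sn n) hn) hc.
  apply: leq_trans (leq_addl _ _); apply: leq_trans h10 _; exact: leq_pmulr.
apply: leq_trans (leq_addr _ _) => {c hc}.
case: n n2 hn pn => // n _ hn pn; apply: leq_trans (nb_diagrams_le_sum _) _; first by lia.
rewrite hM mulnC -mulnA [M * _]mulnC mulnA leq_mul2r; apply/orP; right.
by rewrite mul2n -addnn leq_add2l nb_diagrams_mono //; lia.
Qed.

(** * Density of generating tuples *)

(* Wrapping [d] into an irreducible pattern keeps the insertions below reduced
   even when [d] is the trivial diagram. *)
Definition wrap_src t := N (N t o) o.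
Definition wrap_tgt t := N t (N o o).

Definition f_diag (d : diagram) : diagram := (f_src (wrap_src d.1), f_tgt (wrap_tgt d.2)).
Definition g_diag (d : diagram) : diagram := (g_src (wrap_src d.1), g_tgt (wrap_tgt d.2)).

Lemma exposed_shift t k j : (j \in exposed t k) = (k <= j) && exposed_at t (j - k).
Proof. by rewrite mem_exposed /exposed_at. Qed.

Lemma exposed_bound t j : exposed_at t j -> j.+1 < nleaves t.
Proof. by case/andP => /left_carets_gt0. Qed.

Lemma exposed_node l r k : l <> o \/ r <> o ->
  exposed (N l r) k = exposed l k ++ exposed r (k + nleaves l).
Proof. by case: l => [|l1 l2]; case: r => [|r1 r2] //= []. Qed.

Lemma exposed_f_src t : t <> o ->
  exposed (f_src (wrap_src t)) 0 = exposed t 1 ++ [:: nleaves t + 4].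
Proof.
move=> nt; rewrite /f_src /wrap_src.
do ![rewrite exposed_node; last by [left | right | left; case: (t) nt]].
by rewrite /= !cats0; congr (_ ++ [:: _]); lia.
Qed.

Lemma exposed_f_tgt t : t <> o ->
  exposed (f_tgt (wrap_tgt t)) 0 = exposed t 1 ++ [:: nleaves t + 1; nleaves t + 3].
Proof.
move=> nt; rewrite /f_tgt /wrap_tgt.
do ![rewrite exposed_node; last by [left | right | left; case: (t) nt]].
by rewrite /= -catA /=; congr (_ ++ [:: _; _]); lia.
Qed.

Lemma exposed_g_src t : t <> o ->
  exposed (g_src (wrap_src t)) 0 = 1 :: exposed t 3.
Proof.
move=> nt; rewrite /g_src /wrap_src.
do ![rewrite exposed_node; last by [left | right | left; case: (t) nt]].
by rewrite /= !cats0; case: t nt.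
Qed.

Lemma exposed_g_tgt t : t <> o ->
  exposed (g_tgt (wrap_tgt t)) 0 = exposed t 3 ++ [:: nleaves t + 3].
Proof.
move=> nt; rewrite /g_tgt /wrap_tgt.
do ![rewrite exposed_node; last by [left | right | left; case: (t) nt]].
by rewrite /= !cats0; congr (_ ++ [:: _]); lia.
Qed.

Lemma nleaves_le1 t : nleaves t <= 1 -> t = o.
Proof.
by case: t => // l r /=; have := (nleaves_gt0 l, nleaves_gt0 r) => -[]; lia.
Qed.

(** Carets of [d] are shifted equally in both trees, so they stay unmatched. For n leaves, the
    pattern exposes n + 4 in the source but n + 1 and n + 3 in the target, all beyond the carets of
    [d]. *)
Lemma f_diag_reduced d : reduced d -> reduced (f_diag d).
Proof.
move=> rd; have e := reduced_nleaves rd; case/reducedP: (rd) => ec h.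
have [n1|n1] := leqP (nleaves d.1) 1.
  have e1 := nleaves_le1 n1; have e2 : d.2 = o by apply: nleaves_le1; rewrite -e.
  by rewrite /f_diag e1 e2.
have nt := nleaves_neq_leaf n1; have nu : d.2 <> o by apply: nleaves_neq_leaf; rewrite -e.
apply/andP; split; first by rewrite /=; lia.
rewrite exposed_f_src // exposed_f_tgt //; apply/hasPn => j.
rewrite !mem_cat !inE !exposed_shift => h1; apply/negP => h2.
have [b1 b2] := (@exposed_bound d.1 (j - 1), @exposed_bound d.2 (j - 1)).
have := h (j - 1); move: b1 b2 h1 h2; rewrite e.
by do 2 case: exposed_at; lia.
Qed.

Lemma g_diag_reduced d : reduced d -> reduced (g_diag d).
Proof.
move=> rd; have e := reduced_nleaves rd; case/reducedP: (rd) => ec h.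
have [n1|n1] := leqP (nleaves d.1) 1.
  have e1 := nleaves_le1 n1; have e2 : d.2 = o by apply: nleaves_le1; rewrite -e.
  by rewrite /g_diag e1 e2.
have nt := nleaves_neq_leaf n1; have nu : d.2 <> o by apply: nleaves_neq_leaf; rewrite -e.
apply/andP; split; first by rewrite /=; lia.
rewrite exposed_g_src // exposed_g_tgt //; apply/hasPn => j.
rewrite !mem_cat !inE !exposed_shift => h1; apply/negP => h2.
have [b1 b2] := (@exposed_bound d.1 (j - 3), @exposed_bound d.2 (j - 3)).
have := h (j - 3); move: b1 b2 h1 h2; rewrite e.
by do 2 case: exposed_at; lia.
Qed.

Definition f_elt (x : X) : X := exist _ (f_diag (val x)) (f_diag_reduced (valP x)).
Definition g_elt (x : X) : X := exist _ (g_diag (val x)) (g_diag_reduced (valP x)).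

Lemma f_elt_inj : injective f_elt.
Proof.
move=> [[t u] rd] [[t' u'] rd'] /(congr1 val) [e1 e2]; apply: val_inj => /=.
by rewrite e1 e2.
Qed.

Lemma g_elt_inj : injective g_elt.
Proof.
move=> [[t u] rd] [[t' u'] rd'] /(congr1 val) [e1 e2]; apply: val_inj => /=.
by rewrite e1 e2.
Qed.

Lemma gsize_f_elt x : gsize (f_elt x) = gsize x + 6.
Proof. by rewrite /gsize /=; lia. Qed.

Lemma gsize_g_elt x : gsize (g_elt x) = gsize x + 6.
Proof. by rewrite /gsize /=; lia. Qed.

Lemma elt_in_subgroup (A : {mset X}) (x : X) : x \in A -> in_subgroup A (elt x).
Proof. by move=> h; exists [:: (x, true)]; rewrite /= h. Qed.

Lemma generates_F_insert (A : {mset X}) x y :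
  f_elt x \in A -> g_elt y \in A -> generates_F A.
Proof.
move=> hx hy g.
have hf : tree_rel A (f_src (wrap_src (val x).1)) (f_tgt (wrap_tgt (val x).2)).
  by split; [exact: (reduced_nleaves (valP (f_elt x))) | exact: (elt_in_subgroup hx)].
have hg : tree_rel A (g_src (wrap_src (val y).1)) (g_tgt (wrap_tgt (val y).2)).
  by split; [exact: (reduced_nleaves (valP (g_elt y))) | exact: (elt_in_subgroup hy)].
have [_] := tree_rel_total (tree_rel_congruence A) hf hg (reduced_nleaves (valP g)).
by rewrite -surjective_pairing.
Qed.

(** * Enumerating elements and tuples *)

Definition sphere n : seq X := pmap insub (diagrams n).

Lemma sphere_uniq n : uniq (sphere n).
Proof. by rewrite pmap_sub_uniq ?diagrams_uniq. Qed.

Lemma mem_sphere n x : (x \in sphere n) = (gsize x == n).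
Proof. by rewrite mem_pmap_sub mem_diagrams (valP x). Qed.

Lemma size_sphere n : size (sphere n) = nb_diagrams n.
Proof.
rewrite size_pmap_sub; apply/eqP; rewrite -all_count; apply/allP => d.
by rewrite mem_diagrams => /andP[].
Qed.

Fixpoint ball n : seq X := if n is n'.+1 then ball n' ++ sphere n else sphere 0.

Lemma mem_ball n x : (x \in ball n) = (gsize x <= n).
Proof.
elim: n => [|n IH]; first by rewrite mem_sphere leqn0.
by rewrite mem_cat IH mem_sphere [RHS]leq_eqVlt orbC.
Qed.

Lemma ball_uniq n : uniq (ball n).
Proof.
elim: n => [|n IH]; first exact: sphere_uniq.
rewrite cat_uniq IH sphere_uniq andbT /=; apply/hasPn => x.
by rewrite mem_sphere /= mem_ball => /eqP ->; rewrite ltnn.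
Qed.

Lemma sum_ball n (F : nat -> nat) :
  \sum_(x <- ball n) F (gsize x) = \sum_(0 <= i < n.+1) nb_diagrams i * F i.
Proof.
have E m : \sum_(x <- sphere m) F (gsize x) = nb_diagrams m * F m.
  rewrite big_seq (eq_bigr (fun=> F m)) => [|x]; last by rewrite mem_sphere => /eqP ->.
  by rewrite -big_seq big_const_seq count_predT iter_addn_0 mulnC size_sphere.
elim: n => [|n IH]; first by rewrite big_nat1 E.
by rewrite big_cat IH E [RHS]big_nat_recr.
Qed.

Fixpoint seqs (T : Type) k (s : seq T) : seq (seq T) :=
  if k is k'.+1 then [seq x :: t | x <- s, t <- seqs k' s] else [:: [::]].

Lemma size_seqs (T : Type) k (s : seq T) : size (seqs k s) = size s ^ k.
Proof. by elim: k => //= k IH; rewrite size_allpairs IH expnS. Qed.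

Lemma mem_seqs (T : eqType) k (s t : seq T) :
  (t \in seqs k s) = (size t == k) && all (mem s) t.
Proof.
elim: k t => [|k IH] t /=; first by case: t.
apply/allpairsP/andP => [[[x u] /= [hx hu ->]]|].
  by move: hu; rewrite IH => /andP[/eqP hs ha]; rewrite /= hs eqxx hx ha.
case: t => [|x u] [] //= hs /andP[hx ha]; exists (x, u); split=> //=.
by rewrite IH ha andbT.
Qed.

Lemma seqs_uniq (T : eqType) k (s : seq T) : uniq s -> uniq (seqs k s).
Proof.
move=> us; elim: k => //= k IH; apply: allpairs_uniq => //.
by move=> [x t] [y u] _ _ [-> ->].
Qed.

(* Each multiset of size [k] is the image of at most [k ^ k] sequences. *)
Lemma pos_density_seqs k (Sph : nat -> pred {mset X}) (cover good : nat -> seq (seq X)) M n0 :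
  (forall n A, Sph n A -> size A = k) ->
  (forall n A, n0 <= n -> Sph n A -> exists2 t, t \in cover n & seq_mset t = A) ->
  (forall n, n0 <= n -> uniq (good n)) ->
  (forall n t, n0 <= n -> t \in good n ->
     Sph n (seq_mset t) /\ generates_F (seq_mset t)) ->
  (forall n, n0 <= n -> 0 < size (good n)) ->
  (forall n, n0 <= n -> size (cover n) <= M * size (good n)) ->
  pos_density Sph generates_F.
Proof.
move=> hk hcov hu hgood hpos hM.
(* The factor [k ^ k] accounts for orderings; the successor keeps the denominator nonzero. *)
exists ((M * k ^ k).+1%:R^-1)%R; split; first by rewrite invr_gt0 ltr0Sn.
exists n0 => n hn a b [s [us hs <-]] [s' [us' hs' <-]].
have b_le : size s' <= size (cover n).
  rewrite -(size_map (@seq_mset _)); apply: uniq_leq_size => // A /hs' /(hcov n _ hn)[t ht <-].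
  exact: map_f.
have g_le : size (good n) <= size s * k ^ k.
  (* All sequences of length [k] over the members of [A], hence in particular all its orderings. *)
  pose L := [seq t | A : {mset X} <- s, t <- seqs k (enum_mset A)].
  have -> : size s * k ^ k = size L.
    rewrite size_allpairs_dep; have : {in s, forall A : {mset X}, size (enum_mset A) = k}.
      by move=> A /hs[/hk].
    elim: (s) => //= A s1 IH h; rewrite size_seqs mulSn h ?mem_head // IH //.
    by move=> B hB; rewrite h // inE hB orbT.
  apply: uniq_leq_size; first exact: hu.
  move=> t ht; have [hS hg] := hgood n t hn ht.
  apply/allpairsPdep; exists (seq_mset t), t; split=> //; first by apply/hs.
  rewrite mem_seqs -(perm_size (perm_eq_seq_mset t)) (hk _ _ hS) eqxx; apply/allP => x hx /=.
  by rewrite (perm_mem (perm_eq_seq_mset t)).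
have s_le : size s <= size s' by apply: uniq_leq_size => // A /hs[hA _]; apply/hs'.
have gp := hpos n hn.
have sp : 0 < size s by case: (size s) g_le gp => //; lia.
have s'p : 0 < size s' by exact: leq_trans s_le.
rewrite ler_pdivlMr ?ltr0n // mulrC ler_pdivrMr ?ltr0n // -natrM ler_nat.
apply: leq_trans b_le _; apply: leq_trans (hM n hn) _.
apply: leq_trans (leq_mul (leqnn M) g_le) _.
by rewrite mulnCA leq_mul2l leqnSn orbT.
Qed.

Definition insert (t : seq X) : seq X :=
  if t is x :: y :: u then f_elt x :: g_elt y :: u else t.

Lemma insert_inj k : 2 <= k -> {in [pred t | size t == k] &, injective insert}.
Proof.
move=> hk [|x [|y t]] [|x' [|y' t']] //=; rewrite !inE /=; try lia.
move=> _ _ e; have /f_elt_inj -> := congr1 (head x) e.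
have /g_elt_inj -> := congr1 (nth x ^~ 1) e.
by have := congr1 (drop 2) e; rewrite /= !drop0 => ->.
Qed.

Lemma generates_F_insert_seq t : 2 <= size t -> generates_F (seq_mset (insert t)).
Proof.
case: t => [|x [|y t]] // _; apply: (@generates_F_insert _ x y).
  by rewrite (perm_mem (perm_eq_seq_mset _)) mem_head.
by rewrite (perm_mem (perm_eq_seq_mset _)) !inE eqxx orbT.
Qed.

Lemma sum_norm_seq_mset t : sum_norm (seq_mset t) = \sum_(x <- t) gsize x.
Proof. exact: perm_big (perm_eq_seq_mset t). Qed.

Lemma max_norm_seq_mset t : max_norm (seq_mset t) = \max_(x <- t) gsize x.
Proof. exact: perm_big (perm_eq_seq_mset t). Qed.

Lemma size_seq_mset (t : seq X) : size (seq_mset t) = size t.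
Proof. exact: perm_size (perm_eq_seq_mset t). Qed.

(** * The sum stratification *)

Fixpoint sum_seqs k n : seq (seq X) :=
  if k is k'.+1 then [seq x :: t | x <- ball n, t <- sum_seqs k' (n - gsize x)]
  else if n is 0 then [:: [::]] else [::].

Lemma mem_sum_seqs k n t :
  (t \in sum_seqs k n) = (size t == k) && (\sum_(x <- t) gsize x == n).
Proof.
elim: k n t => [|k IH] n t.
  by case: n => [|n]; case: t => [|x t]; rewrite ?big_nil ?andbF.
apply/allpairsPdep/andP => [[x [u [hx hu ->]]]|[]].
  move: hx hu; rewrite mem_ball IH big_cons => hx /andP[/eqP <- /eqP ->].
  by rewrite subnKC.
case: t => [|x u] //; rewrite big_cons => hs /eqP hn; exists x, u; split=> //.
  by rewrite mem_ball -hn leq_addr.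
by rewrite IH -hn addKn eqxx andbT.
Qed.

Lemma sum_seqs_uniq k n : uniq (sum_seqs k n).
Proof.
elim: k n => [|k IH] n; first by case: n.
apply: allpairs_uniq_dep => [|x _|]; [exact: ball_uniq | exact: IH |].
by move=> [x t] [y u] _ _ [-> ->].
Qed.

Lemma size_sum_seqsS k n : size (sum_seqs k.+1 n) =
  \sum_(0 <= i < n.+1) nb_diagrams i * size (sum_seqs k (n - i)).
Proof.
rewrite size_allpairs_dep sumnE big_map.
exact: (sum_ball n (fun i => size (sum_seqs k (n - i)))).
Qed.

(** Split by the size i of the first entry. If i <= 2, induction applies to the other entries, whose
    sum stays in range because n >= 2(k + 1); if i >= 3, the ratio bound for diagrams, valid from 2
    on, applies to the first entry. *)
Lemma sum_seqs_ratio k : exists C, forall n, 2 * k <= n ->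
  size (sum_seqs k n.+1) <= C * size (sum_seqs k n).
Proof.
have [C hC] := nb_diagrams_ratio.
elim: k => [|k [D hD]]; first by exists 0.
exists (C + D) => n hn; rewrite !size_sum_seqsS mulnDl addnC.
rewrite (big_cat_nat (n := 3)) //=; last by lia.
apply: leq_add.
  apply: (@leq_trans (D * \sum_(0 <= i < 3) nb_diagrams i * size (sum_seqs k (n - i)))).
    rewrite big_distrr /= big_nat_cond [X in _ <= X]big_nat_cond.
    apply: leq_sum => i hi; rewrite mulnCA leq_mul2l; apply/orP; right.
    have -> : n.+1 - i = (n - i).+1 by lia.
    by apply: hD; lia.
  rewrite leq_mul2l; apply/orP; right.
  by rewrite [X in _ <= X](big_cat_nat (n := 3)) ?leq_addr //=; lia.
apply: (@leq_trans (C * \sum_(2 <= i < n.+1) nb_diagrams i * size (sum_seqs k (n - i)))).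
  rewrite big_add1 /= big_distrr /= big_nat_cond [X in _ <= X]big_nat_cond.
  apply: leq_sum => i hi; rewrite mulnA subSS leq_mul2r; apply/orP; right.
  by apply: hC; lia.
rewrite leq_mul2l; apply/orP; right.
by rewrite [X in _ <= X](big_cat_nat (n := 2)) ?leq_addl //=; lia.
Qed.

Lemma ratio_iter (u : nat -> nat) C n0 m n :
  (forall n, n0 <= n -> u n.+1 <= C * u n) -> n0 <= n -> u (n + m) <= C ^ m * u n.
Proof.
move=> h hn; elim: m => [|m IH]; first by rewrite addn0 mul1n.
rewrite addnS expnS -mulnA; apply: leq_trans (h _ _) _; first by lia.
by rewrite leq_mul2l IH orbT.
Qed.

Lemma sphere_neq0 n : n != 1 -> exists x : X, gsize x = n.
Proof.
move=> /nb_diagrams_gt0; rewrite -size_sphere; case E: (sphere n) => [|x s] // _.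
by exists x; apply/eqP; rewrite -mem_sphere E mem_head.
Qed.

Lemma sum_seqs_gt0 k n : 0 < k -> 1 < n -> 0 < size (sum_seqs k n).
Proof.
move=> k0 n1; have [x hx] := @sphere_neq0 n ltac:(lia); have [y hy] := @sphere_neq0 0 isT.
(* One entry carries the whole sum and the others are trivial, so only n = 1 has to be avoided. *)
suff : (x :: nseq k.-1 y) \in sum_seqs k n by case: sum_seqs.
rewrite mem_sum_seqs /= size_nseq prednK // eqxx big_cons hx /=.
by rewrite big_nseq hy iter_addn_0 addn0.
Qed.

Lemma pos_density_sum k : 2 <= k -> pos_density (Sph_sum k) generates_F.
Proof.
move=> hk; have [C hC] := sum_seqs_ratio k.
(* The two insertions add 6 + 6 carets, so the good tuples come from radius n - 12. *)
apply: (@pos_density_seqs k _ (sum_seqs k) (fun n => map insert (sum_seqs k (n - 12)))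
          (C ^ 12) (2 * k + 12)).
- by move=> n A /andP[/eqP].
- move=> n A _ /andP[hA hn]; exists (enum_mset A); last exact: seq_mset_id.
  by rewrite mem_sum_seqs hA.
- move=> n _; rewrite map_inj_in_uniq ?sum_seqs_uniq // => t u ht hu.
  apply: (insert_inj hk); rewrite inE; [move: ht | move: hu]; by rewrite mem_sum_seqs => /andP[].
- move=> n t hn /mapP[u]; rewrite mem_sum_seqs => /andP[/eqP hs /eqP hu] ->.
  split; last by apply: generates_F_insert_seq; rewrite hs.
  rewrite /Sph_sum size_seq_mset sum_norm_seq_mset; case: u hs hu => [|x [|y u]] //=; try lia.
  move=> ->; rewrite !big_cons gsize_f_elt gsize_g_elt eqxx /=; lia.
- by move=> n hn; rewrite size_map sum_seqs_gt0 //; lia.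
move=> n hn; rewrite size_map -{1}(@subnK 12 n); last by lia.
by apply: (ratio_iter _ hC); lia.
Qed.

(** * The max stratification *)

(** The first entry attains the maximum; every multiset has such an ordering, and the count is a
    product of a sphere and powers of a ball. *)
Definition max_seqs k n : seq (seq X) :=
  [seq x :: t | x <- sphere n, t <- seqs k.-1 (ball n)].

Lemma mem_max_seqs k n x t : (x :: t \in max_seqs k n) =
  [&& gsize x == n, size t == k.-1 & all (fun y => gsize y <= n) t].
Proof.
apply/allpairsP/and3P => [[[y u] /= [hy hu [-> ->]]]|[h1 h2 h3]].
  move: hy hu; rewrite mem_sphere mem_seqs => -> /andP[-> h]; split=> //.
  by apply: sub_all h => z /=; rewrite mem_ball.
exists (x, t); split=> //=; first by rewrite mem_sphere.
by rewrite mem_seqs h2; apply: sub_all h3 => z /=; rewrite mem_ball.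
Qed.

Lemma max_seqs_uniq k n : uniq (max_seqs k n).
Proof.
apply: allpairs_uniq; [exact: sphere_uniq | exact/seqs_uniq/ball_uniq |].
by move=> [x t] [y u] _ _ [-> ->].
Qed.

Lemma ball_ratio C : (forall n, 2 <= n -> nb_diagrams n.+1 <= C * nb_diagrams n) ->
  forall n, 2 <= n -> size (ball n.+1) <= C.+1 * size (ball n).
Proof.
move=> hC n hn; rewrite size_cat size_sphere mulSn leq_add2l.
apply: leq_trans (hC n hn) _; rewrite leq_mul2l; apply/orP; right.
by case: n hn => // n _; rewrite size_cat size_sphere leq_addl.
Qed.

Lemma max_seqs_ratio k : exists C, forall n, 2 <= n ->
  size (max_seqs k n.+1) <= C * size (max_seqs k n).
Proof.
have [C hC] := nb_diagrams_ratio; exists (C * C.+1 ^ k.-1) => n hn.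
rewrite !size_allpairs !size_seqs !size_sphere mulnACA -expnMn leq_mul ?hC //.
by case: (k.-1) => // m; rewrite leq_exp2r // ball_ratio.
Qed.

Lemma bigmax_attained (s : seq X) : 0 < size s ->
  exists2 x, x \in s & gsize x = \max_(y <- s) gsize y.
Proof.
elim: s => // x [|y s] IH _; first by exists x; rewrite ?mem_head // big_seq1.
have [z hz ez] := IH isT; rewrite big_cons -ez.
case: (leqP (gsize x) (gsize z)) => h; last by exists x; rewrite ?mem_head //; lia.
by exists z; [rewrite inE hz orbT | lia].
Qed.

Lemma pos_density_max k : 2 <= k -> pos_density (Sph_max k) generates_F.
Proof.
move=> hk; have [C hC] := max_seqs_ratio k.
(* Insertion raises the first entry from n - 6 to n and the second to at most n; the threshold 8
   ensures n - 6 >= 2 for the ratio bound. *)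
apply: (@pos_density_seqs k _ (max_seqs k) (fun n => map insert (max_seqs k (n - 6)))
          (C ^ 6) 8).
- by move=> n A /andP[/eqP].
- move=> n A _ /andP[/eqP hA /eqP hn].
  have [|x hx ex] := @bigmax_attained A; first by rewrite hA; lia.
  have p := perm_to_rem hx; exists (x :: rem x (enum_mset A)).
    rewrite mem_max_seqs size_rem // hA eqxx; apply/andP; split; first by rewrite ex; apply/eqP.
    apply/allP => y /mem_rem hy; rewrite -hn.
    exact: (leq_bigmax_seq (F := gsize)).
  by rewrite -[RHS]seq_mset_id; apply/eq_seq_msetP; rewrite perm_sym.
- move=> n _; rewrite map_inj_in_uniq ?max_seqs_uniq //.
  have sz t : t \in max_seqs k (n - 6) -> t \in [pred t | size t == k].
    case: t => [|x t]; first by case/allpairsP => -[a b] [].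
    by rewrite mem_max_seqs inE /= => /and3P[_ /eqP -> _]; lia.
  by move=> t u /sz ht /sz hu; apply: (insert_inj hk).
- move=> n t hn /mapP[[|x u]]; first by case/allpairsP => -[a b] [].
  rewrite mem_max_seqs => /and3P[/eqP hx /eqP hu ha] ->.
  split; last by apply: generates_F_insert_seq; rewrite /= hu; lia.
  rewrite /Sph_max size_seq_mset max_norm_seq_mset.
  case: u hu ha => [|y u] /=; first by lia.
  move=> hu /andP[hy ha]; rewrite hu prednK ?eqxx /=; last by lia.
  have h : \max_(z <- u) gsize z <= n - 6.
    by apply/bigmax_leqP_seq => z hz _; exact: (allP ha).
  by rewrite !big_cons gsize_f_elt gsize_g_elt; move: (bigop _ _ _) h => m h; lia.
- move=> n hn; rewrite size_map.
  have [x hx] := @sphere_neq0 (n - 6) ltac:(lia).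
  suff : (x :: nseq k.-1 x) \in max_seqs k (n - 6) by case: max_seqs.
  by rewrite mem_max_seqs hx size_nseq !eqxx /=; apply/allP => y /nseqP[-> _]; rewrite hx.
move=> n hn; rewrite size_map -{1}(@subnK 6 n); last by lia.
by apply: (ratio_iter _ hC); lia.
Qed.

Theorem theorem1 (k : nat) (hk : 2 <= k) :
  pos_density (Sph_sum k) generates_F /\ pos_density (Sph_max k) generates_F.
Proof. by split; [exact: pos_density_sum | exact: pos_density_max]. Qed.
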